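(* Assume that $H$ is coercive, i.e. $\lim_{|p|\to\infty}\min_{x\in\mathbb T^n}H_i(x,p)=\infty$ for every $i\in\mathbb I$; that for every $x\in\mathbb T^n$ the matrix $B(x)$ is monotone and irreducible; and that $\sum_{j\in\mathbb I}b_{ij}(x)=0$ for all $(i,x)\in\mathbb I\times\mathbb T^n$. For $\lambda>0$ let $v^\lambda$ be the unique solution of $\lambda v^\lambda+Bv^\lambda+H[v^\lambda]=0$ in $\mathbb T^n$. Then there exist a constant $c^0\in\mathbb R$ and a function $v^0\in\operatorname{Lip}(\mathbb T^n)^m$ such that the functions $v^\lambda+\lambda^{-1}c^0\mathbf 1$ converge to $v^0$ uniformly on $\mathbb T^n$ as $\lambda\to0+$. Moreover, the pair $(c^0\mathbf 1,v^0)$ is a solution of the ergodic problem, i.e. $v^0$ is a solution of $Bv^0+H[v^0]=c^0\mathbf 1$ in $\mathbb T^n$.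
   Context: Let $m,n\in\mathbb N$, $\mathbb I=\{1,\dots,m\}$, let $\mathbb T^n$ be the $n$-dimensional flat torus, $\Xi$ a (nonempty) compact metric space, $g=(g_i)_{i\in\mathbb I}\in C(\mathbb T^n\times\Xi,\mathbb R^n)^m$ and $L=(L_i)_{i\in\mathbb I}\in C(\mathbb T^n\times\Xi)^m$. The Hamiltonian $H=(H_i)_{i\in\mathbb I}$ is given by $H_i(x,p)=\max_{\xi\in\Xi}[-g_i(x,\xi)\cdot p-L_i(x,\xi)]$ for $(x,p)\in\mathbb T^n\times\mathbb R^n$. Let $B=(b_{ij})_{i,j\in\mathbb I}\in C(\mathbb T^n)^{m\times m}$, acting by $(Bu)_i(x)=\sum_{j\in\mathbb I}b_{ij}(x)u_j(x)$. $H[u]$ stands for $(H_i(x,Du_i(x)))_{i\in\mathbb I}$, and $\mathbf 1=(1,\dots,1)\in\mathbb R^m$. Monotone matrix: a real $m\times m$ matrix $A$ is monotone if whenever $u\in\mathbb R^m$ and $u_k=\max_{i\in\mathbb I}u_i\ge0$, then $(Au)_k\ge0$. Irreducible matrix: $B(x)$ is irreducible if for any nonempty $I\subsetneq\mathbb I$ there exist $i\in I$ and $j\in\mathbb I\setminus I$ with $b_{ij}(x)\ne0$. Solutions are viscosity solutions: for $\lambda\ge0$ and $c\in\mathbb R^m$, $u\in C(\mathbb T^n)^m$ is a subsolution (resp. supersolution) of $\lambda u+Bu+H[u]=c$ in $\mathbb T^n$ if for every $i\in\mathbb I$, $\psi\in C^1(\mathbb T^n)$ and every maximum (resp. minimum)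 point $x$ of $u_i-\psi$, one has $\lambda u_i(x)+(Bu)_i(x)+H_i(x,D\psi(x))\le c_i$ (resp. $\ge c_i$); a solution is both. It is known that under coercivity of $H$ and monotonicity of $B$, for each $\lambda>0$ the system with $c=0$ has a unique solution $v^\lambda$, which is Lipschitz. $\operatorname{Lip}(\mathbb T^n)$ is the set of Lipschitz continuous real functions on $\mathbb T^n$. *)

(* Defs.v *)
From mathcomp Require Export all_boot all_order all_algebra.
From mathcomp Require Export all_classical all_reals all_analysis.

Set Implicit Arguments.
Unset Strict Implicit.
Unset Printing Implicit Defensive.

Export Order.TTheory GRing.Theory Num.Theory.
Export numFieldNormedType.Exports.

Local Open Scope classical_set_scope.
Local Open Scope ring_scope.

(* The flat torus is R^n / Z^n: a function on the torus is a function on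
   'rV[R]_n that is invariant under translation by integer vectors.  Hence
   extrema over the torus are extrema over the whole of 'rV[R]_n, and C, C^1
   and Lip of the torus are periodicity plus the same regularity on 'rV[R]_n. *)
Definition periodic (R : realType) (n : nat) (T : Type)
    (f : 'rV[R]_n -> T) : Prop :=
  forall (k : 'rV[int]_n) (x : 'rV[R]_n), f (x + map_mx intr k) = f x.

Definition torus_continuous (R : realType) (n : nat) (f : 'rV[R]_n -> R) : Prop :=
  periodic f /\ continuous f.

Definition gradient (R : realType) (n : nat) (psi : 'rV[R]_n -> R)
    (x : 'rV[R]_n) : 'rV[R]_n :=
  \row_j 'D_(delta_mx 0 j) psi x.

Definition torus_C1 (R : realType) (n : nat) (psi : 'rV[R]_n -> R) : Prop :=
  [/\ periodic psi, forall x, differentiable psi x & continuous (gradient psi)].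

(* The library norm on 'rV[R]_n is the sup norm; it is equivalent to the
   Euclidean one, so the class of Lipschitz functions is the usual one.  For a
   periodic function, being Lipschitz on R^n and being Lipschitz for the
   quotient distance of the torus are the same. *)
Definition torus_Lip (R : realType) (n : nat) (f : 'rV[R]_n -> R) : Prop :=
  periodic f /\ [lipschitz f x | x in [set: 'rV[R]_n]].

Definition dotv (R : realType) (n : nat) (p q : 'rV[R]_n) : R :=
  \sum_k p 0 k * q 0 k.

(* For g and L continuous and Xi compact and nonempty the supremum is attained,
   so that it is the maximum over Xi. *)
Definition hamiltonian (R : realType) (m n : nat) (Xi : Type)
    (g : 'I_m -> 'rV[R]_n * Xi -> 'rV[R]_n) (L : 'I_m -> 'rV[R]_n * Xi -> R)
    (i : 'I_m) (x p : 'rV[R]_n) : R :=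
  sup [set - dotv (g i (x, xi)) p - L i (x, xi) | xi in [set: Xi]].

(* The infimum over x is the minimum when H is continuous and periodic in x. *)
Definition coercive (R : realType) (m n : nat)
    (H : 'I_m -> 'rV[R]_n -> 'rV[R]_n -> R) : Prop :=
  forall (i : 'I_m) (M : R), exists r : R, forall p : 'rV[R]_n,
    r <= `|p| -> M <= inf [set H i x p | x in [set: 'rV[R]_n]].

Definition monotone_mx (R : realType) (m : nat) (A : 'M[R]_m) : Prop :=
  forall (u : 'cV[R]_m) (k : 'I_m),
    (forall i, u i 0 <= u k 0) -> 0 <= u k 0 -> 0 <= (A *m u) k 0.

Definition irreducible_mx (R : realType) (m : nat) (A : 'M[R]_m) : Prop :=
  forall I : {set 'I_m}, I != finset.set0 -> I \proper finset.setT ->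
    exists i j, [/\ i \in I, j \notin I & A i j != 0].

(* Viscosity solutions of lambda u + B u + H[u] = c on the torus. *)
Definition subsolution (R : realType) (m n : nat) (lambda : R)
    (B : 'rV[R]_n -> 'M[R]_m) (H : 'I_m -> 'rV[R]_n -> 'rV[R]_n -> R)
    (c : 'I_m -> R) (u : 'I_m -> 'rV[R]_n -> R) : Prop :=
  (forall i, torus_continuous (u i)) /\
  forall (i : 'I_m) (psi : 'rV[R]_n -> R) (x : 'rV[R]_n),
    torus_C1 psi -> (forall y, u i y - psi y <= u i x - psi x) ->
    lambda * u i x + \sum_j B x i j * u j x + H i x (gradient psi x) <= c i.

Definition supersolution (R : realType) (m n : nat) (lambda : R)
    (B : 'rV[R]_n -> 'M[R]_m) (H : 'I_m -> 'rV[R]_n -> 'rV[R]_n -> R)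
    (c : 'I_m -> R) (u : 'I_m -> 'rV[R]_n -> R) : Prop :=
  (forall i, torus_continuous (u i)) /\
  forall (i : 'I_m) (psi : 'rV[R]_n -> R) (x : 'rV[R]_n),
    torus_C1 psi -> (forall y, u i x - psi x <= u i y - psi y) ->
    c i <= lambda * u i x + \sum_j B x i j * u j x + H i x (gradient psi x).

Definition solution (R : realType) (m n : nat) (lambda : R)
    (B : 'rV[R]_n -> 'M[R]_m) (H : 'I_m -> 'rV[R]_n -> 'rV[R]_n -> R)
    (c : 'I_m -> R) (u : 'I_m -> 'rV[R]_n -> R) : Prop :=
  subsolution lambda B H c u /\ supersolution lambda B H c u.

(* Main.v *)
From mathcomp Require Import ring lra.
Require Import Defs.

Set Implicit Arguments.
Unset Strict Implicit.
Unset Printing Implicit Defensive.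

(** The proof rests on one monotonicity property, which comes from the convexity
of H in p.

Let w solve the ergodic problem with constant c and put
[u_t = v t + t^-1 * c].  As the rows of B sum to zero, u_t solves
[t u + B u + H[u] = c].  Suppose that w <= u_d + D with D >= 0, and let
0 < t < d.  The convex combination (1 - t/d) w + (t/d) u_d, lowered by D, is
then a subsolution of the equation for the discount t, so comparison gives
w <= u_t + 2 D ([ergodic_below]).  Hence, once an ergodic solution is below
some u_d up to an error, it stays below all u_t with t < d up to twice this
error.  It follows that any two cluster points of u_t as t -> 0 are below each
other, and they coincide ([discounted_convergence]).

It remains to produce cluster points that are ergodic solutions.  The functions
t * v t are bounded (constants as test functions); the equation then bounds
B v t from above (H is bounded below), and irreducibility turns this into a
bound on the differences v_i(x) - v_j(x) ([oscillation_bound]).  So H is bounded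
along v t, and coercivity makes the family equi-Lipschitz ([solution_bounds]).
Compactness ([equilipschitz_cluster]) and stability under uniform convergence
([ergodic_stability]) yield an ergodic pair (c, w); comparing u_t with w + M and
w - M shows that u_t is bounded, so that compactness applies to u_t itself.

Convex combinations of viscosity subsolutions are handled by tripling the
variables, which compares a convex combination of two subsolutions directly with
a supersolution ([convex_comparison]).  Throughout, the square of the distance is
replaced by the smooth periodic function [penalty], whose zeros are the integer
vectors. *)

Local Open Scope classical_set_scope.
Local Open Scope ring_scope.

(** * A periodic smooth penalty *)

Lemma continuous_row (T : topologicalType) (R : realType) (n : nat)
    (F : 'I_n -> T -> R) (x : T) :
  (forall k, {for x, continuous (F k)}) ->
  {for x, continuous (fun y => \row_k F k y)}.
Proof.
move=> cF; apply/cvgrPdist_lt => eps e0.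
have : \forall y \near x, forall k, `|F k x - F k y| < eps.
  by apply: filter_forall => k; have /cvgrPdist_lt/(_ _ e0) := cF k.
apply: filterS => y H; rewrite [ltLHS]/Num.norm/= mx_normrE.
by apply/bigmax_ltP; split => // -[a k] _ /=; rewrite !mxE.
Qed.

Section Penalty.
Context (R : realType) (n : nat).
Implicit Types (x y z h e : 'rV[R]_n) (K : R).

(** Test functions have to be periodic and C^1, which excludes the squared
distance; up to second order this function behaves like it near its zeros. *)
Definition penalty h : R := \sum_k (1 - cos (2 * pi * h 0 k)).

Definition penalty_grad h : 'rV[R]_n := \row_k (2 * pi * sin (2 * pi * h 0 k)).

Lemma cos_add_int (t : R) (k : int) : cos (2 * pi * (t + k%:~R)) = cos (2 * pi * t).
Proof.
have cosn (s : R) (j : nat) : cos (s + pi *+ 2 *+ j) = cos s.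
  exact: (periodicn (@cosD2pi R)).
case: k => j.
  have -> : 2 * pi * (t + (Posz j)%:~R) = 2 * pi * t + pi *+ 2 *+ j.
    by rewrite -[_ *+ j]mulr_natr -[pi *+ 2]mulr_natr -pmulrn; ring.
  exact: cosn.
have <- : 2 * pi * (t + (Negz j)%:~R) + pi *+ 2 *+ j.+1 = 2 * pi * t.
  by rewrite -[_ *+ j.+1]mulr_natr -[pi *+ 2]mulr_natr NegzE rmorphN /= -pmulrn; ring.
exact/esym/cosn.
Qed.

Lemma penalty_periodic : periodic penalty.
Proof.
by move=> k x; apply: eq_bigr => i _; rewrite !mxE cos_add_int.
Qed.

Lemma penalty_ge0 h : 0 <= penalty h.
Proof. by apply: sumr_ge0 => k _; rewrite subr_ge0 cos_le1. Qed.

Lemma penalty0 : penalty 0 = 0.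
Proof. by apply: big1 => k _; rewrite mxE mulr0 cos0 subrr. Qed.

Lemma penaltyN h : penalty (- h) = penalty h.
Proof. by apply: eq_bigr => k _; rewrite mxE mulrN cosN. Qed.

Lemma penalty_grad0 : penalty_grad 0 = 0.
Proof. by apply/rowP => k; rewrite !mxE mulr0 sin0 mulr0. Qed.

Lemma penalty_gradN h : penalty_grad (- h) = - penalty_grad h.
Proof. by apply/rowP => k; rewrite !mxE mulrN sinN mulrN. Qed.

Lemma cos2pi_eq1 (t : R) : cos (2 * pi * t) = 1 -> t = (Num.floor t)%:~R.
Proof.
move=> ct; set f := t - (Num.floor t)%:~R.
have f0 : 0 <= f by rewrite subr_ge0 floor_le_tmp.
have f1 : f < 1 by rewrite ltrBlDl; have := floorD1_gt t; rewrite intrD.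
suff : f = 0 by move/eqP; rewrite subr_eq0 => /eqP.
apply/eqP; rewrite eq_le f0 andbT leNgt; apply/negP => fgt0.
have cf : cos (2 * pi * f) = 1.
  by rewrite /f -[RHS]ct -(cos_add_int _ (Num.floor t)) subrK.
have : cos (2 * pi * f) = 1 - 2 * sin (pi * f) ^+ 2.
  rewrite (_ : 2 * pi * f = (pi * f) *+ 2); last by rewrite -mulr_natl; ring.
  by rewrite cos_mulr2n cos2sin2 -mulr_natr; ring.
have : 0 < sin (pi * f :> R).
  apply: sin_gt0_pi; rewrite mulr_gt0 ?pi_gt0//=.
  by rewrite gtr_pMr ?pi_gt0.
rewrite cf => s0 /eqP; rewrite -subr_eq0 opprB addrC subrK mulf_eq0 pnatr_eq0/=.
by rewrite expf_eq0/= (gt_eqF s0).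
Qed.

Lemma penalty_eq0 h : penalty h = 0 -> exists k : 'rV[int]_n, h = map_mx intr k.
Proof.
move=> /eqP; rewrite psumr_eq0; last by move=> k _; rewrite subr_ge0 cos_le1.
move=> /allP hk; exists (\row_k Num.floor (h 0 k)); apply/rowP => k.
rewrite !mxE; apply: cos2pi_eq1; apply/eqP.
by have := hk k (mem_index_enum k); rewrite /= subr_eq0 eq_sym.
Qed.

Lemma coord_le_norm h k : `|h 0 k| <= `|h|.
Proof.
rewrite [leRHS]/Num.norm/= mx_normrE.
exact: (@le_bigmax_cond _ _ _ _ (0, k) predT (fun i => `|h i.1 i.2|)).
Qed.

Lemma sin_lipschitz (a b : R) : `|sin a - sin b| <= `|a - b|.
Proof.
wlog ab : a b / a <= b.
  by move=> W; have [/W//|/ltW/W] := leP a b; rewrite distrC [leRHS]distrC.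
have [|c _ E] := @MVT_segment R sin cos a b ab.
  by apply: continuous_subspaceT => x; exact: continuous_sin.
rewrite distrC E normrM [leRHS]distrC ler_piMl//.
exact: cos_max.
Qed.

Lemma cos_taylor (a b : R) : - cos (a + b) <= - cos a + sin a * b + b ^+ 2.
Proof.
have main (p q : R) : p <= q -> exists2 c, p <= c <= q & cos q - cos p = - sin c * (q - p).
  move=> pq; have [|c cpq E] := @MVT_segment R cos (fun s => - sin s) p q pq.
    by apply: continuous_subspaceT => x; exact: continuous_cos.
  by exists c => //; move: cpq; rewrite in_itv.
have [b0|b0] := leP 0 b.
  have [|c /andP[c1 c2]] := main a (a + b); first by rewrite lerDl.
  rewrite [a + b - a]addrC addKr => E.
  have := sin_lipschitz c a; rewrite [leRHS]ger0_norm ?subr_ge0// ler_norml => /andP[_ S].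
  have : (sin c - sin a) * b <= b * b by apply: ler_wpM2r => //; lra.
  by rewrite expr2; lra.
have [|c /andP[c1 c2]] := main (a + b) a; first by rewrite gerDl ltW.
move=> E.
have := sin_lipschitz a c; rewrite [leRHS]ger0_norm ?subr_ge0// ler_norml => /andP[_ S].
have : (sin a - sin c) * (- b) <= (- b) * (- b) by apply: ler_wpM2r => //; lra.
by rewrite expr2; lra.
Qed.

Definition taylor_const : R := n%:R * (2 * pi) ^+ 2.

(** The quadratic remainder makes the sup-convolution with [penalty]
semiconvex, which is what the Lipschitz estimate uses. *)
Lemma penalty_taylor h e : penalty (h + e) <= penalty h + dotv (penalty_grad h) e + taylor_const * `|e| ^+ 2.
Proof.
have -> : taylor_const * `|e| ^+ 2 = \sum_(k < n) (2 * pi) ^+ 2 * `|e| ^+ 2.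
  by rewrite sumr_const card_ord /taylor_const -mulrA mulr_natl.
rewrite /penalty /dotv.
rewrite -!big_split/=; apply: ler_sum => k _; rewrite !mxE mulrDr.
have := cos_taylor (2 * pi * h 0 k) (2 * pi * e 0 k).
have -> : sin (2 * pi * h 0 k) * (2 * pi * e 0 k) = 2 * pi * sin (2 * pi * h 0 k) * e 0 k.
  by ring.
have : (2 * pi * e 0 k) ^+ 2 <= (2 * pi) ^+ 2 * `|e| ^+ 2.
  rewrite -exprMn -ler_sqrt ?sqr_ge0// !sqrtr_sqr !normrM normr_id.
  by rewrite ler_wpM2l// coord_le_norm.
lra.
Qed.

Lemma gradientD (f g : 'rV[R]_n -> R) x : differentiable f x -> differentiable g x ->
  gradient (fun y => f y + g y) x = gradient f x + gradient g x.
Proof.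
move=> df dg; apply/rowP => k; rewrite !mxE.
by rewrite (@deriveD _ _ _ f g)//; exact: diff_derivable.
Qed.

Lemma gradientZ c (f : 'rV[R]_n -> R) x : differentiable f x ->
  gradient (fun y => c * f y) x = c *: gradient f x.
Proof.
move=> df; apply/rowP => k; rewrite !mxE.
by rewrite (@deriveZ _ _ _ f c)//; exact: diff_derivable.
Qed.

Lemma torus_C1D (f g : 'rV[R]_n -> R) : torus_C1 f -> torus_C1 g ->
  torus_C1 (fun y => f y + g y).
Proof.
move=> [pf df cf] [pg dg cg]; split.
- by move=> k x; rewrite pf pg.
- by move=> x; apply: differentiableD.
- rewrite (_ : gradient _ = gradient f + gradient g).
    by move=> x; apply: continuousD; [exact: cf|exact: cg].
  by apply/funext => x; rewrite gradientD.
Qed.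

Lemma torus_C1Z c (f : 'rV[R]_n -> R) : torus_C1 f -> torus_C1 (fun y => c * f y).
Proof.
move=> [pf df cf]; split.
- by move=> k x; rewrite pf.
- by move=> x; apply: (@differentiableZ _ _ _ f c).
- rewrite (_ : gradient _ = c \*: gradient f).
    by move=> x; apply: continuousZr; exact: cf.
  by apply/funext => x; rewrite gradientZ.
Qed.

Lemma differentiable_cos_coord z k x :
  differentiable (fun y : 'rV[R]_n => cos (2 * pi * (y - z) 0 k)) x.
Proof.
apply: (@differentiable_comp _ _ _ _ (fun y : 'rV[R]_n => 2 * pi * (y - z) 0 k) cos).
  apply: differentiableM; first exact: differentiable_cst.
  rewrite (_ : (fun _ => _) = (fun y : 'rV[R]_n => y 0 k - z 0 k)); last first.
    by apply/funext => y; rewrite !mxE.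
  by apply: differentiableB; [exact: differentiable_coord|exact: differentiable_cst].
by apply/derivable1_diffP.
Qed.

Lemma differentiable_penalty z x : differentiable (fun y => penalty (y - z)) x.
Proof.
have -> : (fun y => penalty (y - z)) =
    \sum_(k < n) (fun y : 'rV[R]_n => 1 - cos (2 * pi * (y - z) 0 k)).
  by apply/funext => y; rewrite fct_sumE.
apply: differentiable_sum => k.
by apply: differentiableB; [exact: differentiable_cst|exact: differentiable_cos_coord].
Qed.

Lemma derive_coord (phi : R -> R) k (v x : 'rV[R]_n) :
  'D_v (fun y : 'rV[R]_n => phi (y 0 k)) x = 'D_(v 0 k) phi (x 0 k).
Proof.
rewrite /derive; set F := (X in lim (X @ _) = _); set G := (X in _ = lim (X @ _)).
by rewrite (_ : F = G)//; apply/funext => t; rewrite /F /G/= !mxE.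
Qed.

Lemma gradient_penalty z x : gradient (fun y => penalty (y - z)) x = penalty_grad (x - z).
Proof.
apply/rowP => j; rewrite !mxE.
have -> : (fun y => penalty (y - z)) =
    \sum_(k < n) (fun y : 'rV[R]_n => 1 - cos (2 * pi * (y - z) 0 k)).
  by apply/funext => y; rewrite fct_sumE.
rewrite derive_sum; last first.
  move=> k; apply: diff_derivable.
  by apply: differentiableB; [exact: differentiable_cst|exact: differentiable_cos_coord].
have E k : 'D_(delta_mx 0 j) (fun y : 'rV[R]_n => 1 - cos (2 * pi * (y - z) 0 k)) x =
    if k == j then 2 * pi * sin (2 * pi * (x - z) 0 j) else 0.
  pose phi (t : R) : R := 1 - cos (2 * pi * (t - z 0 k)).
  rewrite (_ : (fun _ => _) = (fun y : 'rV[R]_n => phi (y 0 k))); last first.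
    by apply/funext => y; rewrite !mxE.
  rewrite derive_coord mxE eqxx/=; case: eqP => [<-|_]; last exact: derive0.
  rewrite !mxE.
  have : is_derive (x 0 k) 1 phi (2 * pi * sin (2 * pi * (x 0 k - z 0 k))).
    rewrite /phi; apply: is_derive_eq.
    by rewrite /GRing.scale/=; ring.
  by case.
rewrite (bigD1 j)//= E eqxx big1 ?addr0 ?mxE// => k /negPf kj.
by rewrite E kj.
Qed.

Lemma continuous_penalty_grad : continuous penalty_grad.
Proof.
move=> h; apply: continuous_row => k; apply: continuousM; first exact: cst_continuous.
apply: (@continuous_comp _ _ _ (fun h => 2 * pi * h 0 k) sin); last exact: continuous_sin.
by apply: continuousM; [exact: cst_continuous|exact: coord_continuous].
Qed.

Lemma torus_C1_penalty K z : torus_C1 (fun y => K * penalty (y - z)).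
Proof.
apply: torus_C1Z; split.
- by move=> k x; rewrite addrAC penalty_periodic.
- by move=> x; exact: differentiable_penalty.
- rewrite (_ : gradient _ = penalty_grad \o (fun y => y - z)).
    move=> x; apply: continuous_comp; last exact: continuous_penalty_grad.
    by apply: continuousB => //; exact: cst_continuous.
  by apply/funext => x; rewrite gradient_penalty.
Qed.

Lemma gradient_scaled_penalty K z x : gradient (fun y => K * penalty (y - z)) x = K *: penalty_grad (x - z).
Proof. by rewrite gradientZ ?gradient_penalty//; exact: differentiable_penalty. Qed.

Lemma continuous_penalty : continuous penalty.
Proof.
move=> x; have := @differentiable_continuous _ _ _ _ _ (differentiable_penalty 0 x).
rewrite (_ : (fun _ => _) = penalty)//.
by apply/funext => y; rewrite subr0.
Qed.

End Penalty.

(** * Compactness of the torus *)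

(** On the compact part of A where G >= eps, phi is positive, hence bounded
below by a positive minimum. *)
Lemma compact_small (T : topologicalType) (R : realType) (A : set T) (phi G : T -> R) :
  compact A -> continuous phi -> continuous G ->
  (forall t, A t -> 0 <= phi t) -> (forall t, A t -> phi t = 0 -> G t <= 0) ->
  forall eps : R, 0 < eps -> exists2 delta : R, 0 < delta &
    forall t, A t -> phi t < delta -> G t < eps.
Proof.
move=> cA cphi cG phi0 G0 eps eps0.
set A' := A `&` [set t | eps <= G t].
have cA' : compact A'.
  apply: compact_closedI => //.
  by apply: (@preimage_closed _ _ G (>= eps)) => //; exact: closed_ge.
have [e|/set0P A'0] := eqVneq A' set0.
  exists 1 => // t At _; rewrite ltNge; apply/negP => Gt.
  by have : A' t by []; rewrite e.
have [c] := compact_EVT_min A'0 cA' (continuous_subspaceT cphi).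
rewrite inE => -[Ac Gc] cmin.
have phic : 0 < phi c.
  rewrite lt_neqAle phi0// andbT eq_sym; apply/eqP => /(G0 _ Ac) Gc0.
  by have := le_trans Gc Gc0; rewrite leNgt eps0.
exists (phi c) => // t At pt; rewrite ltNge; apply/negP => Gt.
have : t \in A' by rewrite inE.
by move=> /cmin; rewrite leNgt pt.
Qed.

Lemma continuous_pair (T U V : topologicalType) (f : T -> U) (g : T -> V) (t : T) :
  {for t, continuous f} -> {for t, continuous g} ->
  {for t, continuous (fun y => (f y, g y))}.
Proof. by move=> cf cg; exact: cvg_pair cf cg. Qed.

Section Torus.
Context (R : realType) (n : nat).
Implicit Types (x y z h p : 'rV[R]_n).

Definition cube (a b : R) : set 'rV[R]_n := [set x | forall i, `[a, b]%classic (x ord0 i)].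

Lemma compact_cube a b : compact (cube a b).
Proof. by apply: (@rV_compact R n (fun=> `[a, b]%classic)) => i; exact: segment_compact. Qed.

Lemma cube0 : cube 0 1 0.
Proof. by move=> i /=; rewrite mxE in_itv/= lexx ler01. Qed.

Lemma norm_le_cube r p : `|p| <= r -> cube (- r) r p.
Proof.
move=> pr i /=; rewrite in_itv/= -ler_norml.
by apply: le_trans pr; exact: coord_le_norm.
Qed.

Lemma translate_to_cube x : exists k : 'rV[int]_n, cube 0 1 (x + map_mx intr k).
Proof.
exists (\row_i - Num.floor (x 0 i)) => i /=; rewrite !mxE rmorphN/= in_itv/=.
rewrite subr_ge0 floor_le_tmp lerBlDl addrC; have := floorD1_gt (x 0 i).
by rewrite intrD => /ltW; rewrite addrC.
Qed.

Lemma periodic_max (f : 'rV[R]_n -> R) : torus_continuous f ->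
  exists x, forall y, f y <= f x.
Proof.
move=> [pf cf].
have [|c _ cm] := compact_EVT_max _ (@compact_cube 0 1) (continuous_subspaceT cf).
  by exists 0; exact: cube0.
exists c => y; have [k yk] := translate_to_cube y.
by rewrite -(pf k); apply: cm; rewrite inE.
Qed.

Lemma torus_continuousN (f : 'rV[R]_n -> R) :
  torus_continuous f -> torus_continuous (fun x => - f x).
Proof.
move=> [pf cf]; split; first by move=> k x; rewrite pf.
by move=> x; apply: continuousN; exact: cf.
Qed.

Lemma torus_continuousD (f g : 'rV[R]_n -> R) :
  torus_continuous f -> torus_continuous g -> torus_continuous (fun x => f x + g x).
Proof.
move=> [pf cf] [pg cg]; split; first by move=> k x; rewrite pf pg.
by move=> x; apply: continuousD; [exact: cf|exact: cg].
Qed.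

Lemma torus_continuousB (f g : 'rV[R]_n -> R) :
  torus_continuous f -> torus_continuous g -> torus_continuous (fun x => f x - g x).
Proof. by move=> cf cg; apply: torus_continuousD => //; exact: torus_continuousN. Qed.

Lemma torus_continuousM (f g : 'rV[R]_n -> R) :
  torus_continuous f -> torus_continuous g -> torus_continuous (fun x => f x * g x).
Proof.
move=> [pf cf] [pg cg]; split; first by move=> k x; rewrite pf pg.
by move=> x; apply: continuousM; [exact: cf|exact: cg].
Qed.

Lemma torus_continuous_cst (a : R) : torus_continuous (fun _ : 'rV[R]_n => a).
Proof. by split => //; exact: cst_continuous. Qed.

Lemma torus_continuous_sum (I : finType) (F : I -> 'rV[R]_n -> R) :
  (forall i, torus_continuous (F i)) -> torus_continuous (fun x => \sum_i F i x).
Proof.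
move=> cF; elim: (index_enum I) => [|i s IH].
  rewrite (_ : (fun _ => _) = fun=> 0); first exact: torus_continuous_cst.
  by apply/funext => x; rewrite big_nil.
rewrite (_ : (fun _ => _) = fun x => F i x + \sum_(j <- s) F j x).
  exact: torus_continuousD.
by apply/funext => x; rewrite big_cons.
Qed.

Lemma torus_C1_continuous (psi : 'rV[R]_n -> R) : torus_C1 psi -> torus_continuous psi.
Proof.
by move=> [pp dp _]; split => // x; exact/differentiable_continuous.
Qed.

Lemma periodic_min (f : 'rV[R]_n -> R) : torus_continuous f ->
  exists x, forall y, f x <= f y.
Proof.
move=> /torus_continuousN/periodic_max [x xm]; exists x => y.
by rewrite -lerN2.
Qed.

Lemma periodic_bounded (f : 'rV[R]_n -> R) : torus_continuous f ->
  exists2 C, 0 <= C & forall x, `|f x| <= C.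
Proof.
move=> cf; have [a am] := periodic_max cf; have [b bm] := periodic_min cf.
exists (`|f a| + `|f b|); first by rewrite addr_ge0.
move=> x; rewrite ler_norml opprD; apply/andP; split.
  have := ler_norm (- f b); have := bm x; have := normr_ge0 (f a).
  by rewrite normrN; lra.
by have := ler_norm (f a); have := am x; have := normr_ge0 (f b); lra.
Qed.

Lemma periodic_max3 (f : 'rV[R]_n -> 'rV[R]_n -> 'rV[R]_n -> R) :
  continuous (fun t : 'rV[R]_n * 'rV[R]_n * 'rV[R]_n => f t.1.1 t.1.2 t.2) ->
  (forall y z, periodic (fun x => f x y z)) ->
  (forall x z, periodic (fun y => f x y z)) ->
  (forall x y, periodic (fun z => f x y z)) ->
  exists x y z, forall x' y' z', f x' y' z' <= f x y z.
Proof.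
move=> cf p1 p2 p3.
have cc : compact (cube 0 1 `*` cube 0 1 `*` cube 0 1).
  by apply: compact_setX; [apply: compact_setX|]; exact: compact_cube.
have [|[[a b] c] _ cm] := compact_EVT_max _ cc (continuous_subspaceT cf).
  by exists (0, 0, 0); split; [split|]; exact: cube0.
exists a, b, c => x y z.
have [k xk] := translate_to_cube x; have [l yl] := translate_to_cube y.
have [j zj] := translate_to_cube z.
rewrite -(p1 _ _ k) -(p2 _ _ l) -(p3 _ _ j).
by apply: (cm (_, _, _)); rewrite inE.
Qed.

(** A small penalty of k means that k is close to an integer vector, but
periodicity makes this as good as k being close to 0. *)
Lemma penalty_modulus (h : 'rV[R]_n -> 'rV[R]_n -> R) (r : R) :
  continuous (fun xp : 'rV[R]_n * 'rV[R]_n => h xp.1 xp.2) ->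
  (forall p, periodic (h ^~ p)) ->
  forall eps : R, 0 < eps -> exists2 delta, 0 < delta &
    forall x k p, `|p| <= r -> penalty k < delta -> `|h (x + k) p - h x p| < eps.
Proof.
move=> ch ph eps eps0.
pose phi (t : 'rV[R]_n * 'rV[R]_n * 'rV[R]_n) := penalty t.1.2.
pose G (t : 'rV[R]_n * 'rV[R]_n * 'rV[R]_n) : R :=
  `|h (t.1.1 + t.1.2) t.2 - h t.1.1 t.2|.
have cc : compact (cube 0 1 `*` cube 0 1 `*` cube (- r) r).
  by apply: compact_setX; [apply: compact_setX|]; exact: compact_cube.
have cphi : continuous phi.
  move=> t; apply: (@continuous_comp _ _ _ (fun t : 'rV[R]_n * 'rV[R]_n * 'rV[R]_n => t.1.2) (@penalty R n)).
    by apply: continuous_comp; [exact: cvg_fst|exact: cvg_snd].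
  exact: continuous_penalty.
have c11 (t : 'rV[R]_n * 'rV[R]_n * 'rV[R]_n) : (fun t => t.1.1) @ t --> t.1.1.
  by apply: (@continuous_comp _ _ _ fst fst t); exact: cvg_fst.
have c12 (t : 'rV[R]_n * 'rV[R]_n * 'rV[R]_n) : (fun t => t.1.2) @ t --> t.1.2.
  by apply: (@continuous_comp _ _ _ fst snd t); [exact: cvg_fst|exact: cvg_snd].
have ca : continuous (fun t : 'rV[R]_n * 'rV[R]_n * 'rV[R]_n => h (t.1.1 + t.1.2) t.2).
  move=> t.
  apply: (@continuous_comp _ _ _ (fun t : 'rV[R]_n * 'rV[R]_n * 'rV[R]_n => (t.1.1 + t.1.2, t.2))
    (fun xp => h xp.1 xp.2)); last exact: ch.
  by apply: continuous_pair; [apply: continuousD; [exact: c11|exact: c12]|exact: cvg_snd].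
have cb : continuous (fun t : 'rV[R]_n * 'rV[R]_n * 'rV[R]_n => h t.1.1 t.2).
  move=> t.
  apply: (@continuous_comp _ _ _ (fun t : 'rV[R]_n * 'rV[R]_n * 'rV[R]_n => (t.1.1, t.2))
    (fun xp => h xp.1 xp.2)); last exact: ch.
  by apply: continuous_pair; [exact: c11|exact: cvg_snd].
have cG : continuous G.
  by move=> t; apply: cvg_norm; apply: cvgB; [exact: ca|exact: cb].
have [||delta d0 H] := compact_small cc cphi cG _ _ eps0.
- by move=> t _; exact: penalty_ge0.
- by move=> t _ /penalty_eq0 [k ek]; rewrite /G ek ph subrr normr0.
exists delta => // x k p pr pk.
have [a xa] := translate_to_cube x; have [b kb] := translate_to_cube k.
rewrite -(ph p a x) -(ph p (a + b)) (_ : x + k + _ = x + map_mx intr a + (k + map_mx intr b)).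
  apply: (H (x + map_mx intr a, k + map_mx intr b, p)).
    by split; [split|exact: norm_le_cube].
  by rewrite /phi/= penalty_periodic.
rewrite map_mxD !addrA; congr (_ + _); rewrite -!addrA; congr (_ + _); exact: addrC.
Qed.

Lemma penalty_modulus1 (f : 'rV[R]_n -> R) : torus_continuous f ->
  forall eps : R, 0 < eps -> exists2 delta, 0 < delta &
    forall x k, penalty k < delta -> `|f (x + k) - f x| < eps.
Proof.
move=> [pf cf] eps eps0.
have [||d d0 H] := @penalty_modulus (fun x _ => f x) 0 _ _ _ eps0.
- by move=> t; apply: (@continuous_comp _ _ _ fst f); [exact: cvg_fst|exact: cf].
- by move=> _.
by exists d => // x k; apply: (H _ _ 0); rewrite normr0.
Qed.

End Torus.

(** * Viscosity inequalities for a single equation *)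

Section Scalar.
Context (R : realType) (n : nat).
Implicit Types (x y z p q : 'rV[R]_n) (h : 'rV[R]_n -> 'rV[R]_n -> R) (a b u s : 'rV[R]_n -> R).

(** The coupling and the discount terms of a system depend on the solution only
through its values; once these are moved to the right-hand side a, each component
satisfies a scalar inequality h(x, Du) <= a in the viscosity sense. *)
Definition visc_sub h a u := forall (psi : 'rV[R]_n -> R) x, torus_C1 psi ->
  (forall y, u y - psi y <= u x - psi x) -> h x (gradient psi x) <= a x.

Definition visc_super h a u := forall (psi : 'rV[R]_n -> R) x, torus_C1 psi ->
  (forall y, u x - psi x <= u y - psi y) -> a x <= h x (gradient psi x).

Definition jointly_continuous h := continuous (fun xp : 'rV[R]_n * 'rV[R]_n => h xp.1 xp.2).

Definition periodic_in_x h := forall p, periodic (h ^~ p).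

Definition uniformly_coercive h := forall M : R, exists r : R, forall x p, r <= `|p| -> M <= h x p.

Definition convex_in_p h := forall x p q (t : R), 0 < t < 1 ->
  h x (t *: p + (1 - t) *: q) <= t * h x p + (1 - t) * h x q.

(** If u is a supersolution for h, then - u is a subsolution for this
Hamiltonian; continuity and periodicity survive, convexity does not. *)
Definition reflected h : 'rV[R]_n -> 'rV[R]_n -> R := fun x p => - h x (- p).

Lemma gradient_opp (psi : 'rV[R]_n -> R) x : torus_C1 psi ->
  gradient (fun y => - psi y) x = - gradient psi x.
Proof.
move=> [_ dp _]; rewrite -scaleN1r -gradientZ//; congr gradient.
by apply/funext => y; rewrite mulN1r.
Qed.

Lemma torus_C1N (psi : 'rV[R]_n -> R) : torus_C1 psi -> torus_C1 (fun y => - psi y).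
Proof.
move=> /(torus_C1Z (-1)); rewrite (_ : (fun y => -1 * psi y) = fun y => - psi y)//.
by apply/funext => y; rewrite mulN1r.
Qed.

Lemma visc_super_opp h a u :
  visc_super h a u <-> visc_sub (reflected h) (fun x => - a x) (fun x => - u x).
Proof.
split=> H psi x psiC1 touch.
  rewrite /reflected lerN2 -gradient_opp//; apply: H; first exact: torus_C1N.
  by move=> y; have := touch y; rewrite !opprK; lra.
have : reflected h x (gradient (fun y => - psi y) x) <= - a x.
  by apply: H; [exact: torus_C1N|move=> y; have := touch y; lra].
by rewrite /reflected lerN2 gradient_opp// opprK.
Qed.

Lemma gradient_periodic (psi : 'rV[R]_n -> R) : periodic psi -> periodic (gradient psi).
Proof.
move=> pp k x; apply/rowP => j; rewrite !mxE /derive.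
set F := (X in lim (X @ _) = _); set G := (X in _ = lim (X @ _)).
rewrite (_ : F = G)//; apply/funext => t; rewrite /F /G/= pp.
by rewrite addrA pp.
Qed.

Lemma continuous_eval h (f : 'rV[R]_n -> 'rV[R]_n) :
  jointly_continuous h -> continuous f -> continuous (fun x => h x (f x)).
Proof.
move=> ch cf x.
apply: (@continuous_comp _ _ _ (fun x => (x, f x)) (fun xp => h xp.1 xp.2)).
  by apply: continuous_pair => //; exact: cf.
exact: ch.
Qed.

(** Adding [penalty] centred at the touching point makes that point the only
maximum on the torus, so that nearby functions are touched near it. *)
Lemma visc_sub_stable h a u : jointly_continuous h -> periodic_in_x h -> torus_continuous a ->
  (forall eps : R, 0 < eps -> exists u' a', [/\ torus_continuous u', visc_sub h a' u',
     forall x, `|u' x - u x| <= eps & forall x, a' x <= a x + eps]) ->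
  visc_sub h a u.
Proof.
move=> ch ph ca approx psi x0 psiC1 touch.
have [pp dp cp] := psiC1.
pose Q x := psi x + 1 * penalty (x - x0).
have QC1 : torus_C1 Q := torus_C1D psiC1 (torus_C1_penalty 1 x0).
pose G x := h x (gradient Q x) - a x.
have cG : torus_continuous G.
  apply: torus_continuousB => //; split.
    by move=> k x; rewrite gradient_periodic ?ph//; have [] := QC1.
  have [_ _ cgQ] := QC1; exact: continuous_eval ch cgQ.
have gradQ : gradient Q x0 = gradient psi x0.
  rewrite gradientD//; last by have [_ + _] := torus_C1_penalty 1 x0; apply.
  by rewrite gradient_scaled_penalty subrr penalty_grad0 scaler0 addr0.
rewrite -gradQ -subr_le0 -/(G x0) leNgt; apply/negP => G0.
have G02 : 0 < G x0 / 2 by lra.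
have [delta d0 Hd] := penalty_modulus1 cG G02.
pose eps := Num.min (delta / 4) (G x0 / 4).
have eps0 : 0 < eps by rewrite lt_min; apply/andP; split; lra.
have e1 : eps <= delta / 4 by rewrite ge_min lexx.
have e2 : eps <= G x0 / 4 by rewrite ge_min lexx orbT.
have [u' [a' [cu' su' uu' aa']]] := approx _ eps0.
have [x' xm] := periodic_max (torus_continuousB cu' (torus_C1_continuous QC1)).
have Gx' : G x' <= eps.
  by have := su' _ _ QC1 xm; have := aa' x'; rewrite /G; lra.
have px' : penalty (x' - x0) < delta.
  have := xm x0; rewrite /Q subrr penalty0 mulr0 addr0 mul1r.
  have := touch x'; have := uu' x0; have := uu' x'; rewrite !ler_norml.
  by move=> /andP[? ?] /andP[? ?]; lra.
have := Hd x0 _ px'; rewrite [x0 + _]addrC subrK ltr_norml => /andP[? ?].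
suff : G x0 < G x0 by rewrite ltxx.
lra.
Qed.

(** Comparing the values at the two points bounds K times the penalty by
the oscillation of u. *)
Lemma penalty_small_at_max u (C delta : R) : 0 < delta -> (forall x, `|u x| <= C) ->
  exists2 K : R, 0 < K & forall x x0, u x0 <= u x - K * penalty (x - x0) -> penalty (x - x0) < delta.
Proof.
move=> d0 uC; set K := (2 * `|C| + 1) / delta.
have K0 : 0 < K by rewrite divr_gt0//; have := normr_ge0 C; lra.
exists K => // x x0 H; rewrite ltNge; apply/negP => dle.
have Kp : 2 * `|C| + 1 <= K * penalty (x - x0).
  by rewrite -(_ : K * delta = 2 * `|C| + 1) ?ler_wpM2l ?(ltW K0)// /K divfK// gt_eqF.
have := uC x; have := uC x0; rewrite !ler_norml => /andP[? ?] /andP[? ?].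
suff : C < C by rewrite ltxx.
have := ler_norm C; lra.
Qed.

(** At touching points a is at least a value of h; steep penalties
produce touching points arbitrarily close to any given point. *)
Lemma visc_sub_lower_bound h a u (C : R) : torus_continuous a -> torus_continuous u ->
  visc_sub h a u -> (forall x p, C <= h x p) -> forall x, C <= a x.
Proof.
move=> ca cu su hC x0; rewrite leNgt; apply/negP => ax0.
have e0 : 0 < C - a x0 by lra.
have [delta d0 Hd] := penalty_modulus1 ca e0.
have [M M0 uM] := periodic_bounded cu.
have [K K0 HK] := penalty_small_at_max d0 uM.
have C1 := torus_C1_penalty K x0.
have [x' xm] := periodic_max (torus_continuousB cu (torus_C1_continuous C1)).
have px' : penalty (x' - x0) < delta.
  by apply: HK; have := xm x0; rewrite subrr penalty0 mulr0 subr0.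
have := Hd x0 _ px'; rewrite [x0 + _]addrC subrK ltr_norml => /andP[? ?].
suff : C < C by rewrite ltxx.
have := le_trans (hC _ _) (su _ _ C1 xm); lra.
Qed.

Lemma dotv_le p q : dotv p q <= n%:R * `|p| * `|q|.
Proof.
rewrite -mulrA mulr_natl -[n in _ *+ n]card_ord -sumr_const.
apply: ler_sum => k _; apply: le_trans (ler_norm _) _; rewrite normrM.
by apply: ler_pM => //; exact: coord_le_norm.
Qed.

(** The sup-convolution V of u satisfies the bound up to a quadratic error,
since the slope of the penalty at a maximum point is a test gradient of u.
Cutting a segment into many pieces removes the error, and V tends to u as the
penalty gets steeper. *)
Lemma gradient_bound_lipschitz u (r : R) : torus_continuous u ->
  visc_sub (fun _ p => `|p|) (fun=> r) u ->
  forall x y, u x - u y <= n%:R * r * `|x - y|.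
Proof.
move=> cu su.
have r0 : 0 <= r.
  have [x xm] := periodic_max (torus_continuousB cu (torus_C1_continuous (torus_C1_penalty 0 0))).
  exact: le_trans (normr_ge0 _) (su _ _ (torus_C1_penalty 0 0) xm).
have conv (K : R) : 0 < K -> exists2 V : 'rV[R]_n -> R,
    forall x y, V x - V y <= n%:R * r * `|x - y| &
    forall x, exists2 y, V x = u y - K * penalty (y - x) & u x <= V x.
  move=> K0.
  have exY x : exists y, forall y', u y' - K * penalty (y' - x) <= u y - K * penalty (y - x).
    exact: periodic_max (torus_continuousB cu (torus_C1_continuous (torus_C1_penalty K x))).
  pose Y x := projT1 (cid (exY x)).
  have YP x : forall y', u y' - K * penalty (y' - x) <= u (Y x) - K * penalty (Y x - x).
    exact: projT2 (cid (exY x)).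
  pose V x := u (Y x) - K * penalty (Y x - x).
  exists V; last first.
    move=> x; exists (Y x) => //.
    by have := YP x x; rewrite subrr penalty0 mulr0 subr0.
  (* the maximum point for x is a competitor in the definition of V y *)
  have loc x y : V x - V y <= n%:R * r * `|x - y| + K * taylor_const R n * `|x - y| ^+ 2.
    have g : dotv (K *: penalty_grad (Y x - x)) (x - y) <= n%:R * r * `|x - y|.
      apply: le_trans (dotv_le _ _) _; rewrite ler_wpM2r// ler_wpM2l//.
      by rewrite -gradient_scaled_penalty; apply: su; [exact: torus_C1_penalty|exact: YP].
    have := YP y (Y x); have := penalty_taylor (Y x - x) (x - y).
    rewrite addrA subrK => T S.
    have gE : dotv (K *: penalty_grad (Y x - x)) (x - y) = K * dotv (penalty_grad (Y x - x)) (x - y).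
      by rewrite /dotv mulr_sumr; apply: eq_bigr => k _; rewrite mxE mulrA.
    have := ler_wpM2l (ltW K0) T; rewrite !mulrDr mulrA -gE /V; lra.
  have iter (d y : 'rV[R]_n) (j : nat) :
      V (y + d *+ j) - V y <= (n%:R * r * `|d| + K * taylor_const R n * `|d| ^+ 2) *+ j.
    elim: j => [|j IH]; first by rewrite !mulr0n addr0 subrr.
    have := loc (y + d *+ j.+1) (y + d *+ j).
    rewrite mulrS [d + _]addrC !addrA [_ + d - _]addrAC subrr add0r mulrS; lra.
  move=> x y; apply/ler_addgt0Pr => eps eps0.
  set e := x - y; set A := K * taylor_const R n * `|e| ^+ 2.
  pose N := (Num.truncn (A / eps)).+1.
  have N0 : 0 < N%:R :> R by rewrite ltr0n.
  have := iter (N%:R^-1 *: e) y N.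
  rewrite -scaler_nat scalerA divff ?gt_eqF// scale1r (_ : y + e = x); last first.
    by rewrite addrC subrK.
  move/le_trans; apply; rewrite normrZ ger0_norm ?invr_ge0 ?ler0n//.
  rewrite -[leLHS]mulr_natl mulrDr exprMn.
  have -> : N%:R * (n%:R * r * (N%:R^-1 * `|e|)) = n%:R * r * `|e|.
    by field; rewrite gt_eqF.
  have -> : N%:R * (K * taylor_const R n * (N%:R^-1 ^+ 2 * `|e| ^+ 2)) = A / N%:R.
    by rewrite /A; field; rewrite gt_eqF.
  rewrite lerD2l ler_pdivrMr// mulrC -ler_pdivrMr//.
  by have := truncnS_gt (A / eps); rewrite -/N => /ltW.
move=> x y; apply/ler_addgt0Pr => eps eps0.
have [delta d0 Hd] := penalty_modulus1 cu eps0.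
have [M M0 uM] := periodic_bounded cu.
have [K K0 HK] := penalty_small_at_max d0 uM.
have [V lipV VP] := conv _ K0.
have [_ _ ux] := VP x; have [z Vz uy] := VP y.
have pz : penalty (z - y) < delta by apply: HK; rewrite -Vz.
have := Hd y _ pz; rewrite [y + _]addrC subrK ltr_norml => /andP[_ ?].
have : 0 <= K * penalty (z - y) by rewrite mulr_ge0 ?penalty_ge0// ltW.
by have := lipV x y; lra.
Qed.

End Scalar.

(** * Comparison with a convex combination of subsolutions *)

Section Comparison.
Context (R : realType) (n : nat).
Implicit Types (x y z p q : 'rV[R]_n) (h : 'rV[R]_n -> 'rV[R]_n -> R) (a b u s : 'rV[R]_n -> R).

(** Both conditions say that a continuous nonnegative function is at most a
multiple of eps somewhere; its minimum is then zero. *)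
Lemma exact_max_of_approx (W G : 'rV[R]_n -> R) : torus_continuous W -> torus_continuous G ->
  (forall eps, 0 < eps -> exists z, (forall y, W y <= W z + eps) /\ G z <= eps) ->
  exists x, (forall y, W y <= W x) /\ G x <= 0.
Proof.
move=> cW cG approx; have [w wm] := periodic_max cW.
(* each summand is nonnegative, the last one being twice the positive part of G *)
pose Q x := (W w - W x) + (G x + `|G x|).
have cabs : torus_continuous (fun x => `|G x|).
  by have [pG ccG] := cG; split=> [k x|x]; [rewrite pG|apply: (continuous_comp (ccG x)); exact: norm_continuous].
have cQ : torus_continuous Q.
  apply: torus_continuousD; last exact: torus_continuousD.
  by apply: torus_continuousB => //; exact: torus_continuous_cst.
have [x xm] := periodic_min cQ; exists x.
have Qx : Q x <= 0.
  apply/ler_addgt0Pr => eps eps0; rewrite add0r.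
  have [|z [Wz Gz]] := approx (eps / 4); first by lra.
  apply: le_trans (xm z) _; rewrite /Q; have := Wz w.
  have [G0|G0] := ler0P (G z); lra.
move: Qx; rewrite /Q => Qx; have Wx := wm x; have Ga := ler_norm (- G x).
rewrite normrN in Ga; have Gb := ler_norm (G x).
split; last by lra.
by move=> y; apply: le_trans (wm y) _; lra.
Qed.

Lemma visc_sub_gradient_bounded h a u : uniformly_coercive h -> torus_continuous a -> visc_sub h a u ->
  exists r : R, visc_sub (fun _ p => `|p|) (fun=> r) u.
Proof.
move=> coer ca su; have [M M0 aM] := periodic_bounded ca.
have [r hr] := coer (M + 1).
exists r => psi x psiC1 touch; rewrite leNgt; apply/negP => /ltW /(hr x).
have := su _ _ psiC1 touch; have := aM x; rewrite ler_norml => /andP[_ A] B C.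
suff : M < M by rewrite ltxx.
lra.
Qed.

(** The point z of the supersolution is tied to one point for each of the two
subsolutions. *)
Lemma tripled_max u1 u2 s (t K : R) :
  torus_continuous u1 -> torus_continuous u2 -> torus_continuous s ->
  exists x y z, forall x' y' z',
    t * u1 x' + (1 - t) * u2 y' - s z' - K * (penalty (x' - z') + penalty (y' - z')) <=
    t * u1 x + (1 - t) * u2 y - s z - K * (penalty (x - z) + penalty (y - z)).
Proof.
move=> [p1 c1] [p2 c2] [ps cs].
apply: (periodic_max3 (f := fun x y z =>
   t * u1 x + (1 - t) * u2 y - s z - K * (penalty (x - z) + penalty (y - z)))).
- move=> w /=.
  have c11 : {for w, continuous (fun w : 'rV[R]_n * 'rV[R]_n * 'rV[R]_n => w.1.1)}.
    by apply: (@continuous_comp _ _ _ fst fst w); exact: cvg_fst.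
  have c12 : {for w, continuous (fun w : 'rV[R]_n * 'rV[R]_n * 'rV[R]_n => w.1.2)}.
    by apply: (@continuous_comp _ _ _ fst snd w); [exact: cvg_fst|exact: cvg_snd].
  have c20 : {for w, continuous (fun w : 'rV[R]_n * 'rV[R]_n * 'rV[R]_n => w.2)}.
    exact: cvg_snd.
  have cc (c : R) : {for w, continuous (fun w : 'rV[R]_n * 'rV[R]_n * 'rV[R]_n => c)}.
    exact: cst_continuous.
  have A1 := continuousM (cc t) (continuous_comp c11 (c1 _)).
  have A2 := continuousM (cc (1 - t)) (continuous_comp c12 (c2 _)).
  have A3 := continuous_comp c20 (cs _).
  have A4 := continuous_comp (continuousB c11 c20) (@continuous_penalty R n _).
  have A5 := continuous_comp (continuousB c12 c20) (@continuous_penalty R n _).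
  have A6 := continuousM (cc K) (continuousD A4 A5).
  exact: (continuousB (continuousB (continuousD A1 A2) A3) A6).
- by move=> y z k x; rewrite p1 [x + _ - z]addrAC penalty_periodic.
- by move=> x z k y; rewrite p2 [y + _ - z]addrAC penalty_periodic.
- move=> x y k z; rewrite ps.
  have E (v : 'rV[R]_n) : penalty (v - (z + map_mx intr k)) = penalty (v - z).
    by rewrite -[LHS](penalty_periodic k) opprD addrA subrK.
  by rewrite !E.
Qed.

(** At a maximum of the tripled functional the test gradients p1 and p2 of the
subsolutions satisfy t p1 + (1 - t) p2 = q, where q is the test gradient of the
supersolution, because the two penalties act on z with the sum of their slopes.
Convexity of h then compares h(z, q) with h(x, p1) and h(y, p2).
By coercivity p1 and p2 stay bounded however steep the penalties are, so the
modulus of continuity of h is uniform and the errors vanish in the limit. *)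
Lemma convex_comparison h a1 a2 b u1 u2 s (t : R) :
  jointly_continuous h -> periodic_in_x h -> uniformly_coercive h -> convex_in_p h -> 0 < t < 1 ->
  torus_continuous a1 -> torus_continuous a2 -> torus_continuous b ->
  torus_continuous u1 -> torus_continuous u2 -> torus_continuous s ->
  visc_sub h a1 u1 -> visc_sub h a2 u2 -> visc_super h b s ->
  exists x, (forall y, t * u1 y + (1 - t) * u2 y - s y <= t * u1 x + (1 - t) * u2 x - s x)
    /\ b x <= t * a1 x + (1 - t) * a2 x.
Proof.
move=> ch ph coer conv t01 ca1 ca2 cb cu1 cu2 cs su1 su2 ss.
have [t0 t1] := andP t01.
have cst := @torus_continuous_cst R n.
have cW : torus_continuous (fun y => t * u1 y + (1 - t) * u2 y - s y).
  by apply: torus_continuousB => //; apply: torus_continuousD; exact: torus_continuousM.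
have cG : torus_continuous (fun y => b y - (t * a1 y + (1 - t) * a2 y)).
  by apply: torus_continuousB => //; apply: torus_continuousD; exact: torus_continuousM.
suff [x [xm xG]] : exists x, (forall y, t * u1 y + (1 - t) * u2 y - s y <=
    t * u1 x + (1 - t) * u2 x - s x) /\ b x - (t * a1 x + (1 - t) * a2 x) <= 0.
  by exists x; split => //; lra.
apply: exact_max_of_approx => // eps' eps'0.
pose eps := eps' / 2; have eps0 : 0 < eps by rewrite /eps; lra.
have [r1 g1] := visc_sub_gradient_bounded coer ca1 su1.
have [r2 g2] := visc_sub_gradient_bounded coer ca2 su2.
have [d1 d10 Hu1] := penalty_modulus1 cu1 eps0.
have [d2 d20 Hu2] := penalty_modulus1 cu2 eps0.
have [d3 d30 Ha1] := penalty_modulus1 ca1 eps0.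
have [d4 d40 Ha2] := penalty_modulus1 ca2 eps0.
have [d5 d50 Hh] := @penalty_modulus R n h (Num.max r1 r2) ch ph _ eps0.
have [d d0 [dd1 dd2 dd3 dd4 dd5]] : exists2 d : R, 0 < d &
    [/\ d <= d1, d <= d2, d <= d3, d <= d4 & d <= d5].
  exists (Num.min d1 (Num.min d2 (Num.min d3 (Num.min d4 d5)))).
    by rewrite !lt_min d10 d20 d30 d40.
  by split; rewrite !ge_min lexx ?orbT.
have [M1 M10 uM1] := periodic_bounded cu1.
have [M2 M20 uM2] := periodic_bounded cu2.
have [Ms Ms0 sM] := periodic_bounded cs.
(* with K = C / d the penalties at a maximum are forced below d *)
pose C := 2 * M1 + 2 * M2 + 2 * Ms + 1.
have C0 : 0 < C by rewrite /C; lra.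
pose K := C / d; have K0 : 0 < K by rewrite divr_gt0.
have Kd : K * d = C by rewrite /K divfK// gt_eqF.
have [x [y [z xyz]]] := tripled_max t K cu1 cu2 cs.
have pxz0 := penalty_ge0 (x - z); have pyz0 := penalty_ge0 (y - z).
have bd (f M v : R) : `|f| <= M -> 0 < v < 1 -> - M <= v * f <= M.
  move=> fM /andP[v0 v1]; rewrite -ler_norml normrM ger0_norm ?(ltW v0)//.
  by apply: le_trans fM; rewrite ler_piMl// ltW.
have t01' : 0 < 1 - t < 1 by apply/andP; split; lra.
have Kpen : K * (penalty (x - z) + penalty (y - z)) < C.
  have := xyz z z z; rewrite subrr penalty0 addr0 mulr0 subr0.
  have /andP[? ?] := bd _ _ _ (uM1 x) t01; have /andP[? ?] := bd _ _ _ (uM1 z) t01.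
  have /andP[? ?] := bd _ _ _ (uM2 y) t01'; have /andP[? ?] := bd _ _ _ (uM2 z) t01'.
  rewrite /C; lra.
have sumd : penalty (x - z) + penalty (y - z) < d.
  by rewrite -(ltr_pM2l K0) Kd.
have pxd : penalty (x - z) < d by lra.
have pyd : penalty (y - z) < d by lra.
have xE : z + (x - z) = x by rewrite addrC subrK.
have yE : z + (y - z) = y by rewrite addrC subrK.
have sub_near (f : 'rV[R]_n -> R) (dd : R) : d <= dd -> (forall w k, penalty k < dd -> `|f (w + k) - f w| < eps) ->
    `|f x - f z| < eps /\ `|f y - f z| < eps.
  move=> ddd Hf; have := Hf z _ (lt_le_trans pxd ddd); have := Hf z _ (lt_le_trans pyd ddd).
  by rewrite xE yE.
have t1n : 1 - t != 0 by rewrite subr_eq0 gt_eqF.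
(* dividing by the weights gives test functions for u1 and u2 themselves *)
pose psi1 x' := K / t * penalty (x' - z).
pose psi2 y' := K / (1 - t) * penalty (y' - z).
pose psi3 z' := - K * penalty (z' - x) + - K * penalty (z' - y).
have C11 : torus_C1 psi1 := torus_C1_penalty _ _.
have C12 : torus_C1 psi2 := torus_C1_penalty _ _.
have C13 : torus_C1 psi3 := torus_C1D (torus_C1_penalty _ _) (torus_C1_penalty _ _).
have tK : t * (K / t) = K by rewrite mulrC divfK// gt_eqF.
have tK' : (1 - t) * (K / (1 - t)) = K by rewrite mulrC divfK.
have t'0 : 0 < 1 - t by lra.
have touch1 x' : u1 x' - psi1 x' <= u1 x - psi1 x.
  rewrite -(ler_pM2l t0) /psi1 !mulrBr !(mulrA t (K / t)) tK.
  have := xyz x' y z; rewrite !mulrDr; lra.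
have touch2 y' : u2 y' - psi2 y' <= u2 y - psi2 y.
  rewrite -(ler_pM2l t'0) /psi2 !mulrBr !(mulrA (1 - t) (K / (1 - t))) tK'.
  have := xyz x y' z; rewrite !mulrDr; lra.
have touch3 z' : s z - psi3 z <= s z' - psi3 z'.
  have penB v w : penalty (v - w) = penalty (w - v :> 'rV[R]_n) by rewrite -penaltyN opprB.
  have := xyz x y z'; rewrite /psi3 !mulrDr !mulNr.
  rewrite (penB z x) (penB z y) (penB z' x) (penB z' y); lra.
pose p1 := (K / t) *: penalty_grad (x - z); pose p2 := (K / (1 - t)) *: penalty_grad (y - z).
have G1 : gradient psi1 x = p1 by exact: gradient_scaled_penalty.
have G2 : gradient psi2 y = p2 by exact: gradient_scaled_penalty.
have G3 : gradient psi3 z = t *: p1 + (1 - t) *: p2.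
  rewrite /psi3 gradientD; [|by have [_ + _] := torus_C1_penalty (- K) x; apply
    |by have [_ + _] := torus_C1_penalty (- K) y; apply].
  rewrite !gradient_scaled_penalty /p1 /p2 !scalerA tK tK' -(opprB x z) -(opprB y z) !penalty_gradN.
  by rewrite !scalerN !scaleNr !opprK.
have P1 : `|p1| <= Num.max r1 r2 by rewrite le_max -G1 g1.
have P2 : `|p2| <= Num.max r1 r2 by rewrite le_max -G2 g2 ?orbT.
have S1 := su1 _ _ C11 touch1; have S2 := su2 _ _ C12 touch2; have S3 := ss _ _ C13 touch3.
rewrite G1 in S1; rewrite G2 in S2; rewrite G3 in S3.
have H1 := Hh z (x - z) p1 P1 (lt_le_trans pxd dd5).
have H2 := Hh z (y - z) p2 P2 (lt_le_trans pyd dd5).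
rewrite xE ltr_norml in H1; rewrite yE ltr_norml in H2.
have [A1 _] := sub_near _ _ dd3 Ha1; have [_ A2] := sub_near _ _ dd4 Ha2.
have [U1 _] := sub_near _ _ dd1 Hu1; have [_ U2] := sub_near _ _ dd2 Hu2.
rewrite !ltr_norml in A1 A2 U1 U2.
have {}S3 := le_trans S3 (conv _ _ _ _ t01).
have T1 : t * h z p1 <= t * (a1 z + eps * 2) by rewrite ler_wpM2l ?(ltW t0)//; lra.
have T2 : (1 - t) * h z p2 <= (1 - t) * (a2 z + eps * 2).
  by rewrite ler_wpM2l ?(ltW t'0)//; lra.
have T3 : t * u1 x <= t * (u1 z + eps) by rewrite ler_wpM2l ?(ltW t0)//; lra.
have T4 : (1 - t) * u2 y <= (1 - t) * (u2 z + eps).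
  by rewrite ler_wpM2l ?(ltW t'0)//; lra.
exists z; split.
  move=> w; have := xyz w w w; rewrite subrr penalty0 addr0 mulr0 subr0.
  have : 0 <= K * (penalty (x - z) + penalty (y - z)) by rewrite mulr_ge0 ?addr_ge0// ltW.
  move: T3 T4; rewrite !mulrDr /eps; lra.
move: T1 T2; rewrite !mulrDr /eps; lra.
Qed.

End Comparison.

(** * The coupling matrix *)

Section Coupling.
Context (R : realType) (m : nat).
Implicit Types (A : 'M[R]_m) (w : 'I_m -> R).

Lemma row_sum_shift A w k (c : R) : (forall i, \sum_j A i j = 0) ->
  \sum_j A k j * (w j - c) = \sum_j A k j * w j.
Proof.
move=> A0; rewrite (eq_bigr (fun j => A k j * w j - A k j * c)) => [|j _].
  by rewrite sumrB -mulr_suml A0 mul0r subr0.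
by rewrite mulrBr.
Qed.

(** Since the rows sum to zero, the maximal entry of w may be shifted to 0, which
removes the sign condition in the definition of a monotone matrix. *)
Lemma row_sum_max A w k : monotone_mx A -> (forall i, \sum_j A i j = 0) ->
  (forall j, w j <= w k) -> 0 <= \sum_j A k j * w j.
Proof.
move=> mA A0 wk.
have := mA (\col_j (w j - w k)) k; rewrite !mxE subrr lexx.
rewrite -(row_sum_shift w k (w k) A0) (eq_bigr (fun j => A k j * (w j - w k))).
  by apply => // i; rewrite !mxE subr_le0.
by move=> j _; rewrite mxE.
Qed.

Lemma row_sum_min A w k : monotone_mx A -> (forall i, \sum_j A i j = 0) ->
  (forall j, w k <= w j) -> \sum_j A k j * w j <= 0.
Proof.
move=> mA A0 wk; rewrite -oppr_ge0 -sumrN.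
rewrite (eq_bigr (fun j => A k j * - w j)); last by move=> j _; rewrite mulrN.
by apply: row_sum_max => // j; rewrite lerN2.
Qed.

(** Test monotonicity with minus the j-th basis vector, which is maximal
at i. *)
Lemma monotone_offdiag A i j : monotone_mx A -> i != j -> A i j <= 0.
Proof.
move=> mA ij; rewrite -oppr_ge0.
have := mA (- delta_mx j 0) i; rewrite !mxE (negPf ij)/= oppr0 lexx.
rewrite (bigD1 j)//= big1 => [|k /negPf kj]; last by rewrite !mxE kj/= oppr0 mulr0.
rewrite !mxE eqxx/= mulrN1 addr0; apply => // k.
by rewrite !mxE eqxx andbT; case: (k == j); rewrite ?oppr0 ?lerN10.
Qed.

(** In the rows where w is maximal all terms A i k * (w k - w i) are nonnegative,
so they vanish: no such row is linked to an index where w is smaller, against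
irreducibility. *)
Lemma irreducible_const A w : monotone_mx A -> irreducible_mx A ->
  (forall i, \sum_j A i j = 0) -> (forall i, \sum_j A i j * w j <= 0) ->
  forall i j, w i = w j.
Proof.
move=> mA iA A0 Aw i0 j0.
pose I := [set i : 'I_m | [forall j, w j <= w i]]%SET.
have maxI i : i \in I -> forall j, w j <= w i by rewrite inE => /forallP.
have [Ifull|Inot] := eqVneq I finset.setT.
  by apply/eqP; rewrite eq_le !maxI// Ifull inE.
have I0 : I != finset.set0.
  apply/finset.set0Pn.
  have [i _ im] := @arg_maxP _ _ _ i0 xpredT w isT.
  by exists i; rewrite inE; apply/forallP => j; exact: im.
have IT : I \proper finset.setT by rewrite finset.properT.
have [i [j [iI jI Aij]]] := iA _ I0 IT.
have wi := maxI _ iI.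
have term k : 0 <= A i k * (w k - w i).
  have [->|ik] := eqVneq i k; first by rewrite subrr mulr0.
  by apply: mulr_le0; rewrite ?subr_le0// monotone_offdiag.
have S0 : \sum_k A i k * (w k - w i) <= 0.
  by rewrite row_sum_shift.
have : A i j * (w j - w i) == 0.
  rewrite eq_le term andbT; apply: le_trans S0.
  by rewrite (bigD1 j)//= lerDl; apply: sumr_ge0.
rewrite mulf_eq0 (negPf Aij)/= subr_eq0 => /eqP wij.
by case/negP: jI; rewrite inE; apply/forallP => k; rewrite wij.
Qed.

End Coupling.

Section OscBound.
Context (R : realType) (m n : nat) (B : 'rV[R]_n -> 'M[R]_m).
Hypothesis B_continuous : forall i j, torus_continuous (fun x => B x i j).
Hypothesis B_monotone : forall x, monotone_mx (B x).
Hypothesis B_irreducible : forall x, irreducible_mx (B x).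
Hypothesis B_row_sum : forall i x, \sum_j B x i j = 0.

Lemma continuous_fsum (T : topologicalType) (I : finType) (F : I -> T -> R) :
  (forall i, continuous (F i)) -> continuous (fun t => \sum_i F i t).
Proof.
move=> cF; elim: (index_enum I) => [|i s IH] t.
  rewrite (_ : (fun _ => _) = fun=> 0); first exact: cst_continuous.
  by apply/funext => x; rewrite big_nil.
rewrite (_ : (fun _ => _) = fun x => F i x + \sum_(j <- s) F j x).
  exact: (continuousD (cF i t) (IH t)).
by apply/funext => x; rewrite big_cons.
Qed.

(** A quantitative version of [irreducible_const], by compactness in x and in w
normalised to the range from 0 to 1: there the sum of the positive parts
of B w is bounded below by a positive number as soon as w oscillates by 1. *)
Lemma oscillation_bound : exists2 kappa : R, 0 <= kappa &
  forall (x : 'rV[R]_n) (w : 'I_m -> R) (C : R), 0 <= C ->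
    (forall i, \sum_j B x i j * w j <= C) -> forall i j, w i - w j <= kappa * C.
Proof.
pose T := ('rV[R]_n * 'rV[R]_m)%type.
pose G i (t : T) := \sum_j B t.1 i j * t.2 0 j.
pose F (t : T) := \sum_i (G i t + `|G i t|).
pose O (t : T) := \sum_i \sum_j `|t.2 0 i - t.2 0 j|.
have cco i : continuous (fun t : T => t.2 0 i).
  move=> t; apply: (@continuous_comp _ _ _ snd (fun w : 'rV[R]_m => w 0 i)); first exact: cvg_snd.
  exact: coord_continuous.
have cB i j : continuous (fun t : T => B t.1 i j).
  move=> t; apply: (@continuous_comp _ _ _ fst (fun x => B x i j)); first exact: cvg_fst.
  exact: (B_continuous i j).2.
have cG i : continuous (G i).
  by apply: continuous_fsum => j t; exact: (continuousM (cB i j t) (cco j t)).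
have cF : continuous F.
  apply: continuous_fsum => i t.
  exact: (continuousD (cG i t) (continuous_comp (cG i t) (@norm_continuous _ _ _))).
have cO : continuous O.
  apply: continuous_fsum => i; apply: continuous_fsum => j t.
  exact: (continuous_comp (continuousB (cco i t) (cco j t)) (@norm_continuous _ _ _)).
have Fterm i t : 0 <= G i t + `|G i t| by have := ler_norm (- G i t); rewrite normrN; lra.
have F0 t : 0 <= F t by apply: sumr_ge0 => i _.
have cK : compact (cube 0 1 `*` cube 0 1 : set T) by apply: compact_setX; exact: compact_cube.
have [||delta d0 Hd] := compact_small cK cF cO _ _ (ltr01 : 0 < 1 :> R).
- by move=> t _.
- move=> t _ Ft; rewrite le_eqVlt; apply/orP; left; apply/eqP.
  apply: big1 => i _; apply: big1 => j _; apply/eqP; rewrite normr_eq0 subr_eq0; apply/eqP.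
  apply: (irreducible_const (A := B t.1) (w := fun j => t.2 0 j)) => // k.
  have /eqP := Ft; rewrite psumr_eq0// => /allP/(_ k (mem_index_enum k)) /eqP.
  by have := normr_ge0 (G k t); rewrite -/(G k t); lra.
exists (2 * m%:R / delta); first by rewrite !mulr_ge0 ?ler0n// invr_ge0 ltW.
move=> x w C C0 Bw i0 j0.
have [a _ am] := @arg_maxP _ _ _ i0 xpredT w isT.
have [b _ bm] := @arg_minP _ _ _ i0 xpredT w isT.
have {}am j : w j <= w a by exact: am.
have {}bm j : w b <= w j by exact: bm.
apply: (@le_trans _ _ (w a - w b)); first exact: lerB.
set om := w a - w b.
have [om0|om0] := leP om 0.
  apply: le_trans om0 _; rewrite !mulr_ge0 ?ler0n// invr_ge0 ltW//.
have [k xk] := translate_to_cube x.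
(* rescale w affinely onto the unit interval; the shift is invisible to B *)
pose W : 'rV[R]_m := \row_j ((w j - w b) / om).
pose t : T := (x + map_mx intr k, W).
have Gt i : G i t <= C / om.
  have -> : G i t = (\sum_j B x i j * w j) / om.
    rewrite -(@row_sum_shift _ _ (B x) w i (w b)) // mulr_suml; apply: eq_bigr => j _.
    by rewrite (B_continuous i j).1 mxE mulrA.
  by rewrite ler_pM2r ?invr_gt0.
have Com : 0 <= C / om by rewrite divr_ge0 ?(ltW om0).
have Ft : F t <= 2 * m%:R * C / om.
  rewrite (_ : 2 * m%:R * C / om = \sum_(i < m) (2 * (C / om))); last first.
    by rewrite sumr_const card_ord -[RHS]mulr_natl; ring.
  apply: ler_sum => i _; have := Gt i.
  by have [_|_] := ler0P (G i t); lra.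
have Ot : 1 <= O t.
  rewrite /O (bigD1 a)//= (bigD1 b)//= !mxE subrr mul0r subr0 -/om divff ?gt_eqF//.
  rewrite normr1 -addrA lerDl addr_ge0// sumr_ge0// => i _.
  by apply: sumr_ge0.
have dF : delta <= F t.
  rewrite leNgt; apply/negP => /Hd; rewrite ltNge Ot => /(_ _)/negP; apply => //.
  split => //= i; rewrite /= in_itv/= mxE divr_ge0 ?subr_ge0 ?bm ?(ltW om0)//=.
  by rewrite ler_pdivrMr// mul1r lerB// am.
have := le_trans dF Ft.
rewrite ler_pdivlMr// [delta * _]mulrC -ler_pdivlMr//.
by move/le_trans; apply; rewrite mulrAC.
Qed.

End OscBound.

(** * The coupled system *)

Section System.
Context (R : realType) (m n : nat) (B : 'rV[R]_n -> 'M[R]_m)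
  (H : 'I_m -> 'rV[R]_n -> 'rV[R]_n -> R).
Hypothesis B_continuous : forall i j, torus_continuous (fun x => B x i j).
Hypothesis B_monotone : forall x, monotone_mx (B x).
Hypothesis B_irreducible : forall x, irreducible_mx (B x).
Hypothesis B_row_sum : forall i x, \sum_j B x i j = 0.
Hypothesis H_continuous : forall i, jointly_continuous (H i).
Hypothesis H_periodic : forall i, periodic_in_x (H i).
Hypothesis H_coercive : forall i, uniformly_coercive (H i).
Hypothesis H_convex : forall i, convex_in_p (H i).
Implicit Types (u v w s : 'I_m -> 'rV[R]_n -> R) (x y : 'rV[R]_n) (c : R).

Definition couple u i x := \sum_j B x i j * u j x.

(** The right-hand side of the i-th scalar equation when the other terms of the
system are moved there. *)
Definition rhs (lambda c : R) u i x := c - lambda * u i x - couple u i x.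

Lemma subsolutionE lambda c u : subsolution lambda B H (fun=> c) u <->
  (forall i, torus_continuous (u i)) /\ (forall i, visc_sub (H i) (rhs lambda c u i) (u i)).
Proof.
split=> -[cu su]; split=> // i psi x psiC1 touch.
  by have := su i psi x psiC1 touch; rewrite /rhs /couple; lra.
by have := su i psi x psiC1 touch; rewrite /rhs /couple; lra.
Qed.

Lemma supersolutionE lambda c u : supersolution lambda B H (fun=> c) u <->
  (forall i, torus_continuous (u i)) /\ (forall i, visc_super (H i) (rhs lambda c u i) (u i)).
Proof.
split=> -[cu su]; split=> // i psi x psiC1 touch.
  by have := su i psi x psiC1 touch; rewrite /rhs /couple; lra.
by have := su i psi x psiC1 touch; rewrite /rhs /couple; lra.
Qed.

Lemma couple_continuous u i : (forall j, torus_continuous (u j)) -> torus_continuous (couple u i).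
Proof.
by move=> cu; apply: torus_continuous_sum => j; exact: torus_continuousM.
Qed.

Lemma rhs_continuous lambda c u i : (forall j, torus_continuous (u j)) ->
  torus_continuous (rhs lambda c u i).
Proof.
move=> cu; apply: torus_continuousB; last exact: couple_continuous.
apply: torus_continuousB; first exact: torus_continuous_cst.
by apply: torus_continuousM => //; exact: torus_continuous_cst.
Qed.

Lemma couple_addc u (d : R) i x : couple (fun j y => u j y + d) i x = couple u i x.
Proof.
rewrite /couple -(@row_sum_shift _ _ (B x) (fun j => u j x) i (- d))//.
by apply: eq_bigr => j _; rewrite opprK.
Qed.

Lemma visc_sub_addc h (a f : 'rV[R]_n -> R) (d : R) : visc_sub h a f -> visc_sub h a (fun y => f y + d).
Proof.
move=> sf psi x psiC1 touch; apply: sf => // y; have := touch y; lra.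
Qed.

Lemma visc_super_addc h (a f : 'rV[R]_n -> R) (d : R) : visc_super h a f -> visc_super h a (fun y => f y + d).
Proof.
move=> sf psi x psiC1 touch; apply: sf => // y; have := touch y; lra.
Qed.

Lemma joint_max u : (forall i, torus_continuous (u i)) -> 'I_m ->
  exists i x, forall j y, u j y <= u i x.
Proof.
move=> cu i0.
pose X i := projT1 (cid (periodic_max (cu i))).
have XP i y : u i y <= u i (X i) by exact: projT2 (cid (periodic_max (cu i))) y.
have [i _ im] := @arg_maxP _ _ _ i0 xpredT (fun i => u i (X i)) isT.
by exists i, (X i) => j y; apply: le_trans (XP j y) _; exact: im.
Qed.

(** Take the component and the point where the difference D of the two sides is
largest.  There B D >= 0 in the corresponding row, so the scalar comparison
leaves lambda D <= 0.  The weighted inequality on a1 and a2 is what makes the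
combination a subsolution of the system. *)
Lemma system_comparison (lambda c t : R) u1 u2 s (a1 a2 : 'I_m -> 'rV[R]_n -> R) :
  0 < lambda -> 0 < t < 1 ->
  (forall i, torus_continuous (a1 i)) -> (forall i, torus_continuous (a2 i)) ->
  (forall i, torus_continuous (u1 i)) -> (forall i, torus_continuous (u2 i)) ->
  (forall i, torus_continuous (s i)) ->
  (forall i, visc_sub (H i) (a1 i) (u1 i)) -> (forall i, visc_sub (H i) (a2 i) (u2 i)) ->
  (forall i, visc_super (H i) (rhs lambda c s i) (s i)) ->
  (forall i x, t * a1 i x + (1 - t) * a2 i x <=
     rhs lambda c (fun j y => t * u1 j y + (1 - t) * u2 j y) i x) ->
  forall i x, t * u1 i x + (1 - t) * u2 i x <= s i x.
Proof.
move=> l0 t01 ca1 ca2 cu1 cu2 cs su1 su2 ss ineq i0 x0.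
pose D i x := t * u1 i x + (1 - t) * u2 i x - s i x.
have cD i : torus_continuous (D i).
  apply: torus_continuousB => //; apply: torus_continuousD;
    by apply: torus_continuousM => //; exact: torus_continuous_cst.
have [i [x0' Dm]] := joint_max cD i0.
rewrite -subr_le0 -/(D i0 x0); apply: le_trans (Dm i0 x0) _.
have cr := rhs_continuous lambda c i cs.
have [x [xm xr]] := convex_comparison (@H_continuous i) (@H_periodic i)
  (@H_coercive i) (@H_convex i) t01 (ca1 i) (ca2 i) cr (cu1 i) (cu2 i) (cs i)
  (su1 i) (su2 i) (ss i).
have {}xm j y : D j y <= D i x by apply: le_trans (Dm j y) _; exact: xm.
have := row_sum_max (@B_monotone x) (B_row_sum^~ x) (fun j => xm j x).
have -> : \sum_j B x i j * D j x = couple (fun j y => t * u1 j y + (1 - t) * u2 j y) i x - couple s i x.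
  by rewrite /couple -sumrB; apply: eq_bigr => j _; rewrite /D mulrBr.
move=> BD; have := le_trans xr (ineq i x); rewrite /rhs => E.
rewrite leNgt; apply/negP => D0.
have {}D0 : 0 < D i x by exact: lt_le_trans D0 (xm i x0').
have : 0 < lambda * D i x by rewrite mulr_gt0.
by rewrite /D mulrBr; lra.
Qed.

Lemma comparison (lambda c : R) u s : 0 < lambda ->
  (forall i, torus_continuous (u i)) -> (forall i, torus_continuous (s i)) ->
  (forall i, visc_sub (H i) (rhs lambda c u i) (u i)) ->
  (forall i, visc_super (H i) (rhs lambda c s i) (s i)) ->
  forall i x, u i x <= s i x.
Proof.
move=> l0 cu cs su ss i x.
have avg (r : R) : 1 / 2 * r + (1 - 1 / 2) * r = r by lra.
rewrite -[leLHS]avg.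
apply: (system_comparison (a1 := rhs lambda c u) (a2 := rhs lambda c u) l0 _ _ _ cu cu cs su su ss).
- by apply/andP; split; lra.
- by move=> j; exact: rhs_continuous.
- by move=> j; exact: rhs_continuous.
move=> j y; rewrite avg (_ : (fun _ _ => _) = u)//.
by apply/funext => k; apply/funext => z; rewrite avg.
Qed.

(** Let t = lambda / delta.  In the combination t ud + (1 - t) w the discount term
of ud contributes t delta ud = lambda ud, so the defect with respect to the
equation for lambda is lambda (1 - t) (w - ud), at most lambda D: lowering the
combination by D absorbs it. *)
Lemma ergodic_below (lambda delta c D : R) w u ud : 0 < lambda < delta -> 0 <= D ->
  solution 0 B H (fun=> c) w -> solution delta B H (fun=> c) ud ->
  solution lambda B H (fun=> c) u ->
  (forall i x, w i x <= ud i x + D) -> forall i x, w i x <= u i x + 2 * D.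
Proof.
move=> /andP[l0 ld] D0 [/subsolutionE[cw sw] _] [/subsolutionE[cd sd] _].
move=> [_ /supersolutionE[cu su]] wud i x.
pose t := lambda / delta.
have d0 : 0 < delta by exact: lt_trans ld.
have t0 : 0 < t by rewrite divr_gt0.
have t1 : t < 1 by rewrite ltr_pdivrMr// mul1r.
have td : t * delta = lambda by rewrite /t divfK// gt_eqF.
have key : t * (ud i x + - D) + (1 - t) * (w i x + - D) <= u i x.
  apply: (system_comparison (a1 := rhs delta c ud) (a2 := rhs 0 c w)
    (u1 := fun i x => ud i x + - D) (u2 := fun i x => w i x + - D) l0 _ _ _ _ _ cu _ _ su).
  - by rewrite t0.
  - by move=> j; exact: rhs_continuous.
  - by move=> j; exact: rhs_continuous.
  - by move=> j; apply: torus_continuousD => //; exact: torus_continuous_cst.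
  - by move=> j; apply: torus_continuousD => //; exact: torus_continuous_cst.
  - by move=> j; exact: visc_sub_addc.
  - by move=> j; exact: visc_sub_addc.
  move=> j y; rewrite /rhs.
  have -> : couple (fun k z => t * (ud k z + - D) + (1 - t) * (w k z + - D)) j y =
      t * couple ud j y + (1 - t) * couple w j y.
    rewrite -(couple_addc ud (- D)) -(couple_addc w (- D)) /couple !mulr_sumr -big_split/=.
    by apply: eq_bigr => k _; ring.
  have : lambda * ((1 - t) * (w j y - ud j y)) <= lambda * D.
    rewrite ler_wpM2l ?(ltW l0)//; apply: (@le_trans _ _ ((1 - t) * D)).
      by rewrite ler_wpM2l//; [lra|have := wud j y; lra].
    by rewrite ler_piMl//; lra.
  have -> : t * (c - delta * ud j y - couple ud j y) =
      t * c - lambda * ud j y - t * couple ud j y by rewrite -td; ring.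
  have -> : lambda * (t * (ud j y + - D) + (1 - t) * (w j y + - D)) =
     lambda * ud j y + lambda * ((1 - t) * (w j y - ud j y)) - lambda * D by ring.
  lra.
have : t * (w i x - D) <= t * ud i x.
  by rewrite ler_wpM2l ?(ltW t0)//; have := wud i x; lra.
have : t * D <= D by rewrite ler_piMl// ltW.
move: key; lra.
Qed.

(** The sum of the constants serves for all indices. *)
Lemma uniform_constant (P : 'I_m -> R -> Prop) :
  (forall i, exists2 C, 0 <= C & P i C) ->
  (forall i C C', C <= C' -> P i C -> P i C') ->
  exists2 C, 0 <= C & forall i, P i C.
Proof.
move=> exC mono.
pose C i := projT1 (cid2 (exC i)).
have C0 i : 0 <= C i by rewrite /C; case: cid2.
have CP i : P i (C i) by rewrite /C; case: cid2.
exists (\sum_i C i); first by apply: sumr_ge0 => i _.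
move=> i; apply: mono (CP i); rewrite (bigD1 i)//= lerDl.
by apply: sumr_ge0 => j _.
Qed.

Lemma B_bounded : exists2 C : R, 0 <= C & forall i x, \sum_j `|B x i j| <= C.
Proof.
apply: (@uniform_constant (fun i C => forall x, \sum_j `|B x i j| <= C)); last first.
  by move=> i C C' CC' HC x; exact: le_trans (HC x) CC'.
move=> i; have [|C CC HC] := @periodic_bounded _ _ (fun x => \sum_j `|B x i j|).
  apply: torus_continuous_sum => j; have [pB cB] := B_continuous i j.
  split; first by move=> k x; rewrite pB.
  by move=> x; apply: (continuous_comp (cB x)); exact: norm_continuous.
by exists C => // x; exact: le_trans (ler_norm _) (HC x).
Qed.

Lemma couple_close u v (eps C : R) i x : (forall i x, \sum_j `|B x i j| <= C) -> 0 <= eps ->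
  (forall j, `|u j x - v j x| <= eps) -> `|couple u i x - couple v i x| <= C * eps.
Proof.
move=> HC e0 uv; rewrite /couple -sumrB; apply: le_trans (ler_norm_sum _ _ _) _.
apply: (@le_trans _ _ (\sum_j `|B x i j| * eps)); last first.
  by rewrite -mulr_suml ler_wpM2r.
by apply: ler_sum => j _; rewrite -mulrBr normrM ler_wpM2l.
Qed.

Lemma coercive_lower_bound h : jointly_continuous h -> periodic_in_x h -> uniformly_coercive h ->
  exists2 C : R, 0 <= C & forall (x p : 'rV[R]_n), - C <= h x p.
Proof.
move=> ch ph coer; have [r hr] := coer 0.
have cK : compact (cube 0 1 `*` cube (- `|r|) `|r| : set ('rV[R]_n * 'rV[R]_n)).
  by apply: compact_setX; exact: compact_cube.
have [|a _ am] := compact_EVT_min _ cK (continuous_subspaceT ch).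
  exists (0, 0); split; first exact: cube0.
  by apply: norm_le_cube; rewrite normr0.
exists `|h a.1 a.2| => // x p.
have [rp|/ltW pr] := leP r `|p|.
  by apply: le_trans (hr x p rp); rewrite oppr_le0.
have [k xk] := translate_to_cube x.
rewrite -(ph p k x); apply: le_trans (am (_, _) _).
  by rewrite lerNl; apply: le_trans (ler_norm _) _; rewrite normrN.
rewrite inE; split => //; apply: norm_le_cube.
exact: le_trans pr (ler_norm _).
Qed.

Lemma cube_dist (x y : 'rV[R]_n) : cube 0 1 x -> cube 0 1 y -> `|x - y| <= 1.
Proof.
move=> x1 y1; rewrite [leLHS]/Num.norm/= mx_normrE; apply/bigmax_leP; split => //.
move=> [a i] _ /=; rewrite (ord1 a) !mxE ler_norml.
have := x1 i; have := y1 i; rewrite /= !in_itv/= => /andP[? ?] /andP[? ?].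
by apply/andP; split; lra.
Qed.

(** Constants as test functions at the joint maximum and minimum bound
lambda v by max |H(x, 0)|.  Since H is bounded below, B v is bounded above,
so that the components stay close to each other by [oscillation_bound] and B v is
bounded on both sides.  Coercivity then bounds the test gradients.  None of the
constants depends on lambda. *)
Lemma solution_bounds (i0 : 'I_m) : exists C Lam D : R, 0 <= C /\
  forall lambda v, 0 < lambda -> solution lambda B H (fun=> 0) v ->
  [/\ forall i x, `|lambda * v i x| <= C,
      forall i x y, `|v i x - v i y| <= Lam * `|x - y| &
      forall i j x y, `|v i x - v j y| <= D].
Proof.
have [C0 C00 HC0] : exists2 C, 0 <= C & forall i x, `|H i x 0| <= C.
  apply: (@uniform_constant (fun i C => forall x, `|H i x 0| <= C)); last first.
    by move=> i C C' CC' HC x; exact: le_trans (HC x) CC'.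
  move=> i; apply: periodic_bounded; split; first exact: H_periodic.
  by apply: (@continuous_eval _ _ (H i) (fun=> 0)) => //; exact: cst_continuous.
have [Cl Cl0 HCl] : exists2 C, 0 <= C & forall i x p, - C <= H i x p.
  apply: (@uniform_constant (fun i C => forall x p, - C <= H i x p)); last first.
    by move=> i C C' CC' HC x p; apply: le_trans (HC x p); rewrite lerN2.
  by move=> i; exact: coercive_lower_bound.
have [kappa k0 osc] := oscillation_bound B_continuous B_monotone B_irreducible B_row_sum.
pose Co := kappa * (Cl + C0).
have Co0 : 0 <= Co by rewrite mulr_ge0// addr_ge0.
have [CB CB0 HCB] := B_bounded.
have [r r0 Hr] : exists2 r, 0 <= r & forall i x p, r <= `|p| -> C0 + CB * Co + 1 <= H i x p.
  apply: (@uniform_constant (fun i r => forall x p, r <= `|p| -> C0 + CB * Co + 1 <= H i x p)).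
    move=> i; have [r Hr] := @H_coercive i (C0 + CB * Co + 1).
    by exists `|r| => // x p rp; apply: Hr; exact: le_trans (ler_norm _) rp.
  by move=> i C C' CC' HC x p rp; apply: HC; exact: le_trans CC' rp.
exists C0, (n%:R * r), (n%:R * r + Co); split => // lambda v l0.
move=> [/subsolutionE[cv sv] /supersolutionE[_ pv]].
have G0 z x : gradient (fun y => 0 * penalty (y - z)) x = 0 :> 'rV[R]_n.
  by rewrite gradient_scaled_penalty scale0r.
have T0 := @torus_C1_penalty R n 0 0.
(* the zero function, written as a null multiple of a penalty, is the test function *)
have hmax i x : (forall j y, v j y <= v i x) -> lambda * v i x <= C0.
  move=> vm; have S : H i x 0 <= rhs lambda 0 v i x.
    by rewrite -(G0 0 x); apply: sv => // y; rewrite !mul0r !subr0.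
  have := row_sum_max (@B_monotone x) (B_row_sum^~ x) (fun j => vm j x).
  have := HC0 i x; rewrite ler_norml => /andP[? ?].
  by move: S; rewrite /rhs /couple; lra.
have hmin i x : (forall j y, v i x <= v j y) -> - C0 <= lambda * v i x.
  move=> vm; have S : rhs lambda 0 v i x <= H i x 0.
    by rewrite -(G0 0 x); apply: pv => // y; rewrite !mul0r !subr0.
  have := row_sum_min (@B_monotone x) (B_row_sum^~ x) (fun j => vm j x).
  have := HC0 i x; rewrite ler_norml => /andP[? ?].
  by move: S; rewrite /rhs /couple; lra.
have lv i x : `|lambda * v i x| <= C0.
  have [a [xa am]] := joint_max cv i0.
  have [b [xb bm]] := joint_max (fun i => torus_continuousN (cv i)) i0.
  have {}bm j y : v b xb <= v j y by rewrite -lerN2.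
  rewrite ler_norml; apply/andP; split.
    by apply: le_trans (hmin _ _ bm) _; rewrite ler_pM2l.
  by apply: le_trans (hmax _ _ am); rewrite ler_pM2l.
have Bv i x : couple v i x <= Cl + C0.
  have := visc_sub_lower_bound (rhs_continuous lambda 0 i cv) (cv i) (sv i) (HCl i) x.
  have := lv i x; rewrite ler_norml => /andP[? ?].
  by rewrite /rhs; lra.
have vo i j x : `|v i x - v j x| <= Co.
  have O k l : v k x - v l x <= Co.
    by apply: (osc x (fun k => v k x)); [exact: addr_ge0|move=> q; exact: Bv].
  by rewrite ler_norml; have := O i j; have := O j i => ? ?; apply/andP; split; lra.
have Bv' i x : - (CB * Co) <= couple v i x.
  have E : couple (fun=> v i) i x = 0 by rewrite /couple -mulr_suml B_row_sum mul0r.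
  have := @couple_close v (fun=> v i) Co CB i x HCB Co0 (fun j => vo j i x).
  by rewrite E subr0 ler_norml => /andP[].
have lip i x y : v i x - v i y <= n%:R * r * `|x - y|.
  apply: gradient_bound_lipschitz => // psi z psiC1 touch.
  rewrite leNgt; apply/negP => /ltW /(Hr i z).
  have := sv i _ _ psiC1 touch; rewrite /rhs; have := Bv' i z.
  have := lv i z; rewrite ler_norml => /andP[? ?] ? ? ?.
  suff : C0 < C0 by rewrite ltxx.
  lra.
have lipn i x y : `|v i x - v i y| <= n%:R * r * `|x - y|.
  have := lip i x y; have := lip i y x; rewrite [`|y - x|]distrC => ? ?.
  by rewrite ler_norml; apply/andP; split; lra.
split => // i j x y.
have [k xk] := translate_to_cube x; have [l yl] := translate_to_cube y.
rewrite -((cv i).1 k) -((cv j).1 l).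
set x' := x + _; set y' := y + _.
rewrite -(subrKA (v i y')); apply: le_trans (ler_normD _ _) _; apply: lerD => //.
apply: le_trans (lipn _ _ _) _; rewrite -[leRHS]mulr1 ler_wpM2l ?mulr_ge0 ?ler0n//.
exact: cube_dist.
Qed.

End System.

(** * Cluster points of equi-Lipschitz families *)

Section Arzela.
Context (R : realType).

(** For an ultrafilter a cluster point is a limit. *)
Lemma bounded_ultra_cvg (U : set_system R) (f : R -> R) (C : R) : UltraFilter U ->
  (\forall t \near U, `|f t| <= C) -> exists l : R, f @ U --> l.
Proof.
move=> UU fC.
have cC : compact `[- C, C]%classic by exact: segment_compact.
have [|l [_ lc]] := cC (f @ U) _.
  by near=> t; rewrite /= in_itv/= -ler_norml; near: t.
exists l => A lA; have [//|nA] := in_ultra_setVsetC (f @^-1` A) UU.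
by have [y [nAy Ay]] := lc (~` A) A nA lA.
Unshelve. all: by end_near. Qed.

Lemma right_accumulation_proper (S : set R) :
  (forall delta : R, 0 < delta -> exists t, S t /\ 0 < t < delta) ->
  ProperFilter (within S (0^'+)).
Proof.
move=> acc; apply: Build_ProperFilter_ex => P.
rewrite /at_right /within/= => /nbhs_ballP[e /= e0 He].
have [t [St /andP[t0 te]]] := acc _ e0.
exists t; apply: He => //.
by rewrite /ball/= sub0r normrN gtr0_norm.
Qed.

(** Along an ultrafilter the pointwise limits exist for all points at once, which
avoids extracting subsequences; the common Lipschitz constant and the compactness
of the cube make the convergence uniform.  S restricts the parameters that may be
used, so that a cluster point can be found with a prescribed property. *)
Lemma equilipschitz_cluster (n : nat) (T : finType) (S : set R)
    (f : R -> T -> 'rV[R]_n -> R) (C Lam : R) :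
  (forall delta : R, 0 < delta -> exists t, S t /\ 0 < t < delta) ->
  (forall t i x, 0 < t -> `|f t i x| <= C) ->
  (forall t i x y, 0 < t -> `|f t i x - f t i y| <= Lam * `|x - y|) ->
  (forall t i, 0 < t -> periodic (f t i)) ->
  exists w : T -> 'rV[R]_n -> R,
    [/\ forall i x y, `|w i x - w i y| <= Lam * `|x - y|,
        forall i, periodic (w i) &
        forall eps delta : R, 0 < eps -> 0 < delta -> exists t,
          [/\ S t, 0 < t < delta & forall i x, `|f t i x - w i x| <= eps]].
Proof.
move=> acc fC flip fper.
have PS := right_accumulation_proper acc.
have [U [UU SU]] := ultraFilterLemma PS.
have Upos : \forall t \near U, 0 < t.
  by apply: SU; apply: filterS (nbhs_right_gt 0) => t t0 _.
have US : U S by apply: SU; rewrite /within/=; exact: filterE.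
have exl i x : exists l : R, f ^~ i ^~ x @ U --> l.
  by apply: (@bounded_ultra_cvg _ _ C) => //; apply: filterS Upos => t /fC.
pose w i x := projT1 (cid (exl i x)).
have wl i x : f ^~ i ^~ x @ U --> w i x by exact: projT2 (cid (exl i x)).
have wlip i x y : `|w i x - w i y| <= Lam * `|x - y|.
  have cv : (fun t => `|f t i x - f t i y|) @ U --> `|w i x - w i y|.
    by apply: cvg_norm; apply: cvgB; exact: wl.
  apply: (cvgr_to_le cv); by apply: filterS Upos => t; exact: flip.
have wper i : periodic (w i).
  move=> k x; apply/eqP; rewrite -subr_eq0 -normr_le0.
  have cv : (fun t => `|f t i (x + map_mx intr k) - f t i x|) @ U -->
      `|w i (x + map_mx intr k) - w i x|.
    by apply: cvg_norm; apply: cvgB; exact: wl.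
  apply: (cvgr_to_le cv); apply: filterS Upos => t t0.
  by rewrite fper// subrr normr0.
exists w; split => // eps delta eps0 delta0.
have Lam0 : 0 < `|Lam| + 1 by rewrite ltr_wpDl.
have unif i : \forall t \near U, cube 0 1 `<=` (fun x => `|f t i x - w i x| <= eps).
  have /compact_near_coveringP cov := @compact_cube R n 0 1.
  apply: (cov R U (fun t x => `|f t i x - w i x| <= eps)) => x _.
  have e3 : 0 < eps / 3 by lra.
  have N1 : \forall x' \near x, `|x - x'| < eps / 3 / (`|Lam| + 1).
    have r0 : 0 < eps / 3 / (`|Lam| + 1) by rewrite divr_gt0.
    by have := nbhsx_ballx x _ r0; rewrite -ball_normE.
  have N2 : \forall t \near U, 0 < t /\ `|w i x - f t i x| < eps / 3.
    apply: filterI => //; have /cvgrPdist_lt := wl i x; exact.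
  exists ([set x' | `|x - x'| < eps / 3 / (`|Lam| + 1)],
          [set t | 0 < t /\ `|w i x - f t i x| < eps / 3]) => //.
  move=> [x' t] /= [xx' [t0 wt]].
  have L : Lam * `|x - x'| <= eps / 3.
    apply: (@le_trans _ _ ((`|Lam| + 1) * `|x - x'|)).
      by rewrite ler_wpM2r//; have := ler_norm Lam; lra.
    by rewrite mulrC -ler_pdivlMr// ltW.
  have := le_trans (flip t i x x' t0) L; have := le_trans (wlip i x x') L.
  move: wt => /ltW; rewrite !ler_norml => /andP[? ?] /andP[? ?] /andP[? ?].
  by apply/andP; split; lra.
have unifall : \forall t \near U, forall i, cube 0 1 `<=` (fun x => `|f t i x - w i x| <= eps).
  by apply: filter_forall => i; exact: unif.
have Usmall : \forall t \near U, t < delta.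
  by apply: SU; apply: filterS (nbhs_right_lt delta0) => t t0 _.
have [t [[[t0 St] td] ut]] := filter_ex (filterI (filterI (filterI Upos US) Usmall) unifall).
exists t; split => //; first by rewrite t0.
move=> i x; have [k xk] := translate_to_cube x.
by rewrite -(fper t i t0 k) -(wper i k); exact: ut.
Qed.

End Arzela.

(** * The ergodic problem *)

Lemma continuous_at_dist (R : realType) (T : topologicalType) (f : T -> R) (x : T) :
  (forall eps : R, 0 < eps -> \forall y \near x, `|f x - f y| < eps) -> {for x, continuous f}.
Proof. by move=> H; apply/cvgrPdist_lt. Qed.

Section Ergodic.
Context (R : realType) (m n : nat) (B : 'rV[R]_n -> 'M[R]_m)
  (H : 'I_m -> 'rV[R]_n -> 'rV[R]_n -> R).
Hypothesis B_continuous : forall i j, torus_continuous (fun x => B x i j).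
Hypothesis B_monotone : forall x, monotone_mx (B x).
Hypothesis B_irreducible : forall x, irreducible_mx (B x).
Hypothesis B_row_sum : forall i x, \sum_j B x i j = 0.
Hypothesis H_continuous : forall i, jointly_continuous (H i).
Hypothesis H_periodic : forall i, periodic_in_x (H i).
Hypothesis H_coercive : forall i, uniformly_coercive (H i).
Hypothesis H_convex : forall i, convex_in_p (H i).

(** Shifting by k changes neither the gradients nor B v, and lambda v is close
to - c, so each component satisfies a scalar equation with nearly the right-hand
side of the limit.  The super half follows by reflection. *)
Lemma ergodic_stability (c : R) (w : 'I_m -> 'rV[R]_n -> R) :
  (forall i, torus_continuous (w i)) ->
  (forall eps : R, 0 < eps -> exists lambda v k, [/\ solution lambda B H (fun=> 0) v,
     forall i x, `|v i x + k - w i x| <= eps & forall i x, `|lambda * v i x + c| <= eps]) ->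
  solution 0 B H (fun=> c) w.
Proof.
move=> cw approx.
have [C C0 HC] := B_bounded B_continuous.
have close (eps : R) : 0 < eps -> exists lambda v k, [/\ solution lambda B H (fun=> 0) v,
    forall i x, `|v i x + k - w i x| <= eps &
    forall i x, `|rhs B lambda 0 v i x - rhs B 0 c w i x| <= eps].
  move=> eps0; have e0 : 0 < eps / (1 + C) by rewrite divr_gt0// ltr_pwDl.
  have [lambda [v [k [sv vw lv]]]] := approx _ e0.
  exists lambda, v, k; split => // i x.
    by apply: le_trans (vw i x) _; rewrite ler_pdivrMr ?ltr_pwDl// ler_peMr ?(ltW eps0)// lerDl.
  have := @couple_close _ _ _ B (fun j y => v j y + k) w _ _ i x HC (ltW e0) (fun j => vw j x).
  rewrite (couple_addc B_row_sum v k) => D.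
  have -> : rhs B lambda 0 v i x - rhs B 0 c w i x =
    - ((lambda * v i x + c) + (couple B v i x - couple B w i x)) by rewrite /rhs; ring.
  rewrite normrN; apply: le_trans (ler_normD _ _) _; apply: le_trans (lerD (lv i x) D) _.
  by rewrite -[X in X + _]mul1r -mulrDl mulrC divfK// gt_eqF// ltr_pwDl.
have crw i : torus_continuous (rhs B 0 c w i) by exact: rhs_continuous.
split.
  apply/subsolutionE; split => // i; apply: visc_sub_stable => // eps eps0.
  have [lambda [v [k [[/subsolutionE[cv sv] _] vw rr]]]] := close _ eps0.
  exists (fun x => v i x + k), (rhs B lambda 0 v i); split.
  - by apply: torus_continuousD => //; exact: torus_continuous_cst.
  - exact: visc_sub_addc.
  - by [].
  - by move=> x; have := rr i x; rewrite ler_norml => /andP[? ?]; lra.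
apply/supersolutionE; split => // i; apply/visc_super_opp; apply: visc_sub_stable.
- move=> t; apply: continuousN.
  apply: (@continuous_comp _ _ _ (fun xp : 'rV[R]_n * 'rV[R]_n => (xp.1, - xp.2))
    (fun xp => H i xp.1 xp.2)); last exact: H_continuous.
  apply: continuous_pair; first exact: cvg_fst.
  by apply: continuousN; exact: cvg_snd.
- by move=> p k x; rewrite /reflected H_periodic.
- exact: torus_continuousN.
move=> eps eps0; have [lambda [v [k [[_ /supersolutionE[cv sv]] vw rr]]]] := close _ eps0.
exists (fun x => - (v i x + k)), (fun x => - rhs B lambda 0 v i x); split.
- by apply: torus_continuousN; apply: torus_continuousD => //; exact: torus_continuous_cst.
- by apply/(visc_super_opp (H i) (rhs B lambda 0 v i) (fun x => v i x + k)); exact: visc_super_addc.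
- by move=> x; rewrite -opprD normrN.
- by move=> x; have := rr i x; rewrite ler_norml => /andP[? ?]; lra.
Qed.

(** The rows of B sum to zero, so the constant is seen only by the discount
term. *)
Lemma solution_shift (lambda c : R) v : 0 < lambda -> solution lambda B H (fun=> 0) v ->
  solution lambda B H (fun=> c) (fun i x => v i x + lambda^-1 * c).
Proof.
move=> l0 [/subsolutionE[cv sv] /supersolutionE[_ pv]].
have cu i : torus_continuous (fun x => v i x + lambda^-1 * c).
  by apply: torus_continuousD => //; exact: torus_continuous_cst.
have E i : rhs B lambda c (fun i x => v i x + lambda^-1 * c) i = rhs B lambda 0 v i.
  apply/funext => x; rewrite /rhs (couple_addc B_row_sum) mulrDr mulrA divff ?gt_eqF//.
  ring.
split; [apply/subsolutionE|apply/supersolutionE]; split => // i; rewrite E.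
  exact: visc_sub_addc.
exact: visc_super_addc.
Qed.

(** w + M is nonnegative and w - M is nonpositive, so the discount term makes them a
super- and a subsolution of the discounted equation. *)
Lemma ergodic_bounds_discounted (c M : R) w (lambda : R) u : 0 < lambda -> 0 <= M ->
  (forall i x, `|w i x| <= M) -> solution 0 B H (fun=> c) w ->
  solution lambda B H (fun=> c) u -> forall i x, `|u i x| <= 2 * M.
Proof.
move=> l0 M0 wM [/subsolutionE[cw sw] /supersolutionE[_ pw]].
move=> [/subsolutionE[cu su] /supersolutionE[_ pu]] i x.
have cwd d j : torus_continuous (fun x => w j x + d).
  by apply: torus_continuousD => //; exact: torus_continuous_cst.
have hi : u i x <= w i x + M.
  apply: (comparison B_continuous B_monotone B_row_sum H_continuous H_periodic
    H_coercive H_convex (s := fun i x => w i x + M) l0 cu _ su) => // j psi y psiC1 touch.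
  have := visc_super_addc (d := M) (pw j) psiC1 touch; rewrite /rhs (couple_addc B_row_sum).
  have := wM j y; rewrite ler_norml => /andP[? ?].
  have : 0 <= lambda * (w j y + M) by rewrite mulr_ge0 ?(ltW l0)//; lra.
  lra.
have lo : w i x + - M <= u i x.
  apply: (comparison B_continuous B_monotone B_row_sum H_continuous H_periodic
    H_coercive H_convex (u := fun i x => w i x + - M) l0 _ cu _ pu) => // j psi y psiC1 touch.
  have := visc_sub_addc (d := - M) (sw j) psiC1 touch; rewrite /rhs (couple_addc B_row_sum).
  have := wM j y; rewrite ler_norml => /andP[? ?].
  have : lambda * (w j y + - M) <= 0 by rewrite mulr_ge0_le0 ?(ltW l0)//; lra.
  lra.
have := wM i x; rewrite !ler_norml => /andP[? ?].
by apply/andP; split; lra.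
Qed.

Lemma lipschitz_torus_continuous (f : 'rV[R]_n -> R) (Lam : R) :
  periodic f -> (forall x y, `|f x - f y| <= Lam * `|x - y|) -> torus_continuous f.
Proof.
move=> pf lf; split => // x; apply: continuous_at_dist => eps eps0.
have r0 : 0 < eps / (`|Lam| + 1) by rewrite divr_gt0// ltr_wpDl.
have := nbhsx_ballx x _ r0; rewrite -ball_normE; apply: filterS => y /= xy.
apply: le_lt_trans (lf x y) _; apply: (@le_lt_trans _ _ ((`|Lam| + 1) * `|x - y|)).
  by rewrite ler_wpM2r//; have := ler_norm Lam; lra.
by rewrite mulrC -ltr_pdivlMr// ltr_wpDl.
Qed.

Context (v : R -> 'I_m -> 'rV[R]_n -> R).
Hypothesis v_solution : forall lambda, 0 < lambda -> solution lambda B H (fun=> 0) (v lambda).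

(** Apart from the normalised functions v t i - v t i0 0, the number t * v t i0 0
has to converge, along the same parameters: it is one more member of the
family, indexed by [None]. *)
Lemma ergodic_pair_exists (i0 : 'I_m) : exists c w, solution 0 B H (fun=> c) w.
Proof.
have [C [Lam [D [C0 bd]]]] := solution_bounds B_continuous B_monotone B_irreducible
  B_row_sum H_continuous H_periodic H_coercive i0.
pose f (t : R) (o : option 'I_m) (x : 'rV[R]_n) :=
  if o is Some i then v t i x - v t i0 0 else t * v t i0 0.
have [||||w [wlip wper wapp]] := @equilipschitz_cluster R n (option 'I_m) setT f (C + `|D|) `|Lam|.
- by move=> d d0; exists (d / 2); split => //; apply/andP; split; lra.
- move=> t [i|] x t0; have [lv _ vD] := bd t _ t0 (v_solution t0); rewrite /f.
    by apply: le_trans (vD _ _ _ _) _; have := ler_norm D; lra.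
  by apply: le_trans (lv _ _) _; rewrite lerDl.
- move=> t [i|] x y t0; have [_ lv _] := bd t _ t0 (v_solution t0); rewrite /f.
    rewrite opprB addrA subrK; apply: le_trans (lv i x y) _.
    by rewrite ler_wpM2r// ler_norm.
  by rewrite subrr normr0 mulr_ge0.
- move=> t [i|] t0 k x //=; have [[cv _] _] := v_solution t0.
  by rewrite /f (cv i).1.
exists (- w None 0), (fun i => w (Some i)); apply: ergodic_stability => [i|eps eps0].
  exact: lipschitz_torus_continuous (wlip _).
have dl0 : 0 < eps / 2 / (`|D| + 1) by rewrite divr_gt0 ?ltr_wpDl//; lra.
have e2 : 0 < eps / 2 by lra.
have [t [_ /andP[t0 td] tw]] := wapp _ _ e2 dl0.
exists t, (v t), (- v t i0 0); split; first exact: v_solution.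
  by move=> i x; have := tw (Some i) x; rewrite /f => /le_trans; apply; lra.
move=> i x.
have [_ _ vD] := bd t _ t0 (v_solution t0).
rewrite (_ : t * v t i x - w None 0 = t * (v t i x - v t i0 0) + (f t None 0 - w None 0)).
  apply: le_trans (ler_normD _ _) _; have := tw None 0.
  suff : `|t * (v t i x - v t i0 0)| <= eps / 2 by lra.
  rewrite normrM gtr0_norm//; apply: (@le_trans _ _ (t * (`|D| + 1))).
    by rewrite ler_pM2l//; have := vD i i0 x 0; have := ler_norm D; lra.
  by rewrite -ler_pdivlMr ?ltr_wpDl// ltW.
rewrite /f; ring.
Qed.

(** Let w be a cluster point; by [ergodic_below] the shifted solutions are eventually
above w - eps.  If they exceeded w + eps for arbitrarily small discounts, these
discounts would carry a cluster point w' exceeding w somewhere.  But w' is also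
ergodic, so [ergodic_below] puts it below the shifted solutions, hence
below w. *)
Lemma discounted_convergence (i0 : 'I_m) : exists c w, [/\ solution 0 B H (fun=> c) w,
  (exists Lam : R, forall i x y, `|w i x - w i y| <= Lam * `|x - y|) &
  forall eps : R, 0 < eps -> exists2 delta, 0 < delta & forall lambda, 0 < lambda < delta ->
    forall i x, `|v lambda i x + lambda^-1 * c - w i x| <= eps].
Proof.
have [c [w0 sw0]] := ergodic_pair_exists i0.
pose u t i x := v t i x + t^-1 * c.
have us t : 0 < t -> solution t B H (fun=> c) (u t).
  by move=> t0; apply: solution_shift => //; exact: v_solution.
have [M M0 wM] : exists2 M : R, 0 <= M & forall i x, `|w0 i x| <= M.
  apply: (@uniform_constant _ _ (fun i C => forall x, `|w0 i x| <= C)); last first.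
    by move=> i C C' CC' HC x; exact: le_trans (HC x) CC'.
  by move=> i; apply: periodic_bounded; have [[cw _] _] := sw0.
have uM t i x : 0 < t -> `|u t i x| <= 2 * M.
  by move=> t0; apply: (ergodic_bounds_discounted t0 M0 wM sw0); exact: us.
have [C [Lam [D [C0 bd]]]] := solution_bounds B_continuous B_monotone B_irreducible
  B_row_sum H_continuous H_periodic H_coercive i0.
have cluster (S : set R) : (forall d : R, 0 < d -> exists t, S t /\ 0 < t < d) ->
    exists w : 'I_m -> 'rV[R]_n -> R, [/\ solution 0 B H (fun=> c) w,
      forall i x y, `|w i x - w i y| <= Lam * `|x - y| &
      forall eps d : R, 0 < eps -> 0 < d -> exists t,
        [/\ S t, 0 < t < d & forall i x, `|u t i x - w i x| <= eps]].
  move=> acc.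
  have [||||w [wlip wper wapp]] := @equilipschitz_cluster R n 'I_m S u (2 * M) Lam.
  - exact: acc.
  - by move=> t i x; exact: uM.
  - move=> t i x y t0; have [_ lv _] := bd t _ t0 (v_solution t0).
    by rewrite /u opprD addrACA subrr addr0.
  - by move=> t i t0; have [[cu _] _] := us t t0; exact: (cu i).1.
  exists w; split => //; apply: ergodic_stability => [i|eps eps0].
    exact: lipschitz_torus_continuous (wlip i).
  have dl0 : 0 < eps / (2 * M + 1) by rewrite divr_gt0//; lra.
  have [t [_ /andP[t0 td] tw]] := wapp _ _ eps0 dl0.
  exists t, (v t), (t^-1 * c); split => //; first exact: v_solution.
  move=> i x; rewrite (_ : t * v t i x + c = t * u t i x); last first.
    by rewrite /u mulrDr mulrA divff ?gt_eqF// mul1r.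
  rewrite normrM gtr0_norm//; apply: (@le_trans _ _ (t * (2 * M + 1))).
    by rewrite ler_pM2l//; have := uM t i x t0; lra.
  by rewrite -ler_pdivlMr; [exact: ltW|lra].
have [|w [sw wlip wapp]] := cluster setT.
  by move=> d d0; exists (d / 2); split => //; apply/andP; split; lra.
have below w' : solution 0 B H (fun=> c) w' -> forall eps d : R, 0 < eps ->
    0 < d -> (forall i x, `|u d i x - w' i x| <= eps) ->
    forall t, 0 < t < d -> forall i x, w' i x <= u t i x + 2 * eps.
  move=> sw' eps d eps0 d0 close t td i x; have [t0 _] := andP td.
  apply: (ergodic_below B_continuous B_monotone B_row_sum H_continuous H_periodic
    H_coercive H_convex td (ltW eps0) sw' (us _ d0) (us _ t0)) => j y.
  by have := close j y; rewrite ler_norml => /andP[? ?]; lra.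
exists c, w; split => //; first by exists Lam.
move=> eps eps0; have e2 : 0 < eps / 2 by lra.
have [d1 [_ /andP[d10 _] close1]] := wapp _ _ e2 ltr01.
apply: contrapT => none.
(* the discounts at which the upper bound fails *)
pose S : set R := [set t | 0 < t /\ exists i x, w i x + eps < u t i x].
have accS (d : R) : 0 < d -> exists t, S t /\ 0 < t < d.
  move=> d0; apply: contrapT => noS; apply: none.
  exists (Num.min d d1); first by rewrite lt_min d0.
  move=> t /andP[t0]; rewrite lt_min => /andP[td td1] i x.
  have := below w sw _ _ e2 d10 close1 t _ i x; rewrite t0 td1 => /(_ isT) lo.
  have hi : u t i x <= w i x + eps.
    rewrite leNgt; apply/negP => bad; apply: noS; exists t; rewrite t0 td.
    by split => //; split => //; exists i, x.
  by rewrite -/(u t i x) ler_norml; apply/andP; split; lra.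
have [w' [sw' _ w'app]] := cluster S accS.
have w'w i x : w' i x <= w i x.
  apply/ler_addgt0Pr => e e0; have e3 : 0 < e / 3 by lra.
  have [d [_ /andP[d0 _] close]] := w'app _ _ e3 ltr01.
  have [t [_ td tclose]] := wapp _ _ e3 d0.
  have := below w' sw' _ _ e3 d0 close t td i x; have := tclose i x.
  by rewrite ler_norml => /andP[? ?]; lra.
have [t [[t0 [i [x bad]]] _ close]] := w'app _ _ e2 ltr01.
have := close i x; have := w'w i x; rewrite ler_norml => ? /andP[? ?].
suff : eps < eps by rewrite ltxx.
lra.
Qed.

End Ergodic.

(** * The Hamiltonian *)

Section Hamiltonian.
Context (R : realType) (m n : nat) (Xi : topologicalType).
Hypothesis Xi_nonempty : [set: Xi] !=set0.
Hypothesis Xi_compact : compact [set: Xi].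
Context (g : 'I_m -> 'rV[R]_n * Xi -> 'rV[R]_n) (L : 'I_m -> 'rV[R]_n * Xi -> R).
Hypothesis g_periodic : forall i xi, periodic (fun x => g i (x, xi)).
Hypothesis g_continuous : forall i, continuous (g i).
Hypothesis L_periodic : forall i xi, periodic (fun x => L i (x, xi)).
Hypothesis L_continuous : forall i, continuous (L i).
Implicit Types (x p q : 'rV[R]_n) (xi : Xi).

Definition cost i x p xi : R := - dotv (g i (x, xi)) p - L i (x, xi).

Lemma continuous_cost i :
  continuous (fun t : 'rV[R]_n * 'rV[R]_n * Xi => cost i t.1.1 t.1.2 t.2).
Proof.
have c1 : continuous (fun t : 'rV[R]_n * 'rV[R]_n * Xi => (t.1.1, t.2)).
  move=> t; apply: (@continuous_pair _ _ _ (fun t : 'rV[R]_n * 'rV[R]_n * Xi => t.1.1) snd).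
    by apply: (@continuous_comp _ _ _ fst fst t); exact: cvg_fst.
  exact: cvg_snd.
have c2 : continuous (fun t : 'rV[R]_n * 'rV[R]_n * Xi => t.1.2).
  by move=> t; apply: (@continuous_comp _ _ _ fst snd t); [exact: cvg_fst|exact: cvg_snd].
have cg k : continuous (fun t : 'rV[R]_n * 'rV[R]_n * Xi => g i (t.1.1, t.2) 0 k).
  move=> t; apply: (@continuous_comp _ _ _ (fun t => g i (t.1.1, t.2)) (fun v => v 0 k)).
    exact: (continuous_comp (c1 t) (@g_continuous i _)).
  exact: coord_continuous.
have cp k : continuous (fun t : 'rV[R]_n * 'rV[R]_n * Xi => t.1.2 0 k).
  move=> t; apply: (@continuous_comp _ _ _ (fun t : 'rV[R]_n * 'rV[R]_n * Xi => t.1.2) (fun v : 'rV[R]_n => v 0 k)); first exact: c2.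
  exact: coord_continuous.
have cd : continuous (fun t : 'rV[R]_n * 'rV[R]_n * Xi => dotv (g i (t.1.1, t.2)) t.1.2).
  by apply: continuous_fsum => k t; exact: (continuousM (cg k t) (cp k t)).
have cL : continuous (fun t : 'rV[R]_n * 'rV[R]_n * Xi => L i (t.1.1, t.2)).
  by move=> t; exact: (continuous_comp (c1 t) (@L_continuous i _)).
move=> t; exact: (continuousB (continuousN (cd t)) (cL t)).
Qed.

Lemma cost_has_sup i x p : has_sup [set cost i x p xi | xi in [set: Xi]].
Proof.
apply: compact_has_sup; first exact: image_nonempty.
apply: continuous_compact => //; apply: continuous_subspaceT => xi.
apply: (@continuous_comp _ _ _ (fun xi => (x, p, xi))
  (fun t : 'rV[R]_n * 'rV[R]_n * Xi => cost i t.1.1 t.1.2 t.2)); last exact: continuous_cost.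
by apply: continuous_pair; [exact: cst_continuous|exact: cvg_id].
Qed.

Lemma cost_le_hamiltonian i x p xi : cost i x p xi <= hamiltonian g L i x p.
Proof.
by apply: sup_upper_bound; [exact: cost_has_sup|exists xi].
Qed.

Lemma hamiltonian_le i x p (M : R) :
  (forall xi, cost i x p xi <= M) -> hamiltonian g L i x p <= M.
Proof.
move=> cM; apply: ge_sup; first exact: image_nonempty.
by move=> _ [xi _ <-]; exact: cM.
Qed.

Lemma hamiltonian_periodic i : periodic_in_x (hamiltonian g L i).
Proof.
move=> p k x; rewrite /hamiltonian; congr (sup _); apply/seteqP.
by split=> _ [xi _ <-]; exists xi => //; rewrite (g_periodic i xi k) (L_periodic i xi k).
Qed.

Lemma hamiltonian_convex i : convex_in_p (hamiltonian g L i).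
Proof.
move=> x p q t /andP[t0 t1]; apply: hamiltonian_le => xi.
have -> : cost i x (t *: p + (1 - t) *: q) xi = t * cost i x p xi + (1 - t) * cost i x q xi.
  rewrite /cost /dotv !mulrBr -!sumrN !mulr_sumr.
  have -> : \sum_k - (g i (x, xi) 0 k * (t *: p + (1 - t) *: q) 0 k) =
    \sum_k t * - (g i (x, xi) 0 k * p 0 k) + \sum_k (1 - t) * - (g i (x, xi) 0 k * q 0 k).
    by rewrite -big_split/=; apply: eq_bigr => k _; rewrite !mxE; ring.
  ring.
apply: lerD; apply: ler_wpM2l; rewrite ?subr_ge0 ?(ltW t0) ?(ltW t1)//;
  exact: cost_le_hamiltonian.
Qed.

(** Compactness of Xi makes the continuity of the maximised expression uniform in
the control, and a uniform bound passes to suprema. *)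
Lemma hamiltonian_continuous i : jointly_continuous (hamiltonian g L i).
Proof.
move=> xp; apply: continuous_at_dist => eps eps0.
have /compact_near_coveringP cov := Xi_compact.
have e2 : 0 < eps / 2 by lra.
have e4 : 0 < eps / 4 by lra.
have near_cost : \forall y \near xp, [set: Xi] `<=` (fun xi =>
    `|cost i xp.1 xp.2 xi - cost i y.1 y.2 xi| <= eps / 2).
  apply: (cov _ (nbhs xp) (fun y xi =>
    `|cost i xp.1 xp.2 xi - cost i y.1 y.2 xi| <= eps / 2)) => xi _.
  have /cvgrPdist_lt/(_ _ e4) := @continuous_cost i ((xp, xi) : 'rV[R]_n * 'rV[R]_n * Xi).
  move=> [[A1 A2] /= [nA1 nA2] HA].
  exists (A2, A1) => //= -[xi' y] /= [A2xi A1y].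
  have := HA (y, xi') (conj A1y A2xi).
  have := HA (xp, xi') (conj (nbhs_singleton nA1) A2xi).
  rewrite /= !ltr_norml ler_norml => /andP[? ?] /andP[? ?].
  by apply/andP; split; lra.
apply: filterS near_cost => y Hy.
have le1 : hamiltonian g L i xp.1 xp.2 <= hamiltonian g L i y.1 y.2 + eps / 2.
  apply: hamiltonian_le => xi; have := Hy xi I; have := cost_le_hamiltonian i y.1 y.2 xi.
  by rewrite ler_norml => ? /andP[? ?]; lra.
have le2 : hamiltonian g L i y.1 y.2 <= hamiltonian g L i xp.1 xp.2 + eps / 2.
  apply: hamiltonian_le => xi; have := Hy xi I; have := cost_le_hamiltonian i xp.1 xp.2 xi.
  by rewrite ler_norml => ? /andP[? ?]; lra.
by rewrite ltr_norml; apply/andP; split; lra.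
Qed.

(** The infimum over x is a lower bound because H is continuous and periodic in x,
hence bounded below for each p. *)
Lemma coercive_uniformly : coercive (hamiltonian g L) ->
  forall i, uniformly_coercive (hamiltonian g L i).
Proof.
move=> coer i M; have [r Hr] := coer i M; exists r => x p rp.
apply: le_trans (Hr p rp) _; apply: ge_inf; last by exists x.
have [C _ HC] : exists2 C : R, 0 <= C & forall y, `|hamiltonian g L i y p| <= C.
  apply: periodic_bounded; split; first exact: hamiltonian_periodic.
  apply: (@continuous_eval _ _ (hamiltonian g L i) (fun=> p)).
    exact: hamiltonian_continuous.
  exact: cst_continuous.
exists (- C) => _ [y _ <-].
by have := HC y; rewrite ler_norml => /andP[].
Qed.

End Hamiltonian.

Theorem theorem16 (R : realType) (m n : nat) (m_gt0 : (0 < m)%N) (n_gt0 : (0 < n)%N)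
  (Xi : metricType R) (Xi_nonempty : [set: Xi] !=set0)
  (Xi_compact : compact [set: Xi])
  (g : 'I_m -> 'rV[R]_n * Xi -> 'rV[R]_n)
  (g_periodic : forall i xi, periodic (fun x => g i (x, xi)))
  (g_continuous : forall i, continuous (g i))
  (L : 'I_m -> 'rV[R]_n * Xi -> R)
  (L_periodic : forall i xi, periodic (fun x => L i (x, xi)))
  (L_continuous : forall i, continuous (L i))
  (B : 'rV[R]_n -> 'M[R]_m)
  (B_continuous : forall i j, torus_continuous (fun x => B x i j))
  (H_coercive : coercive (hamiltonian g L))
  (B_monotone : forall x, monotone_mx (B x))
  (B_irreducible : forall x, irreducible_mx (B x))
  (B_row_sum : forall i x, \sum_j B x i j = 0)
  (v : R -> 'I_m -> 'rV[R]_n -> R)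
  (v_solution : forall lambda : R, 0 < lambda ->
     solution lambda B (hamiltonian g L) (fun=> 0) (v lambda)) :
  exists (c0 : R) (v0 : 'I_m -> 'rV[R]_n -> R),
    [/\ forall i, torus_Lip (v0 i),
        forall i, {uniform,
          (fun (lambda : R) (x : 'rV[R]_n) => v lambda i x + lambda^-1 * c0)
            @ 0^'+ --> v0 i}
      & solution 0 B (hamiltonian g L) (fun=> c0) v0].
Proof.
have H_unif_coercive := coercive_uniformly Xi_nonempty Xi_compact g_periodic g_continuous
  L_periodic L_continuous H_coercive.
have H_continuous := @hamiltonian_continuous R m n Xi Xi_nonempty Xi_compact g L
  g_continuous L_continuous.
have H_periodic := @hamiltonian_periodic R m n Xi g L g_periodic L_periodic.
have H_convex := @hamiltonian_convex R m n Xi Xi_nonempty Xi_compact g L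
  g_continuous L_continuous.
have [c [w [sw [Lam wlip] cvg]]] := discounted_convergence B_continuous B_monotone
  B_irreducible B_row_sum H_continuous H_periodic H_unif_coercive H_convex
  v_solution (Ordinal m_gt0).
exists c, w; split => //.
  move=> i; split; first by have [[cw _] _] := sw; exact: (cw i).1.
  have PF : ProperFilter (globally ([set: 'rV[R]_n] `*` [set: 'rV[R]_n])).
    exact: (@globally_properfilter _ _ (0, 0)).
  by apply: (@klipschitzW _ _ _ Lam) => -[x y] _ /=; exact: wlip.
move=> i P /uniform_nbhs[E [/= entE EP]].
have [eps eps0 epsE] : exists2 eps : R, 0 < eps & forall a b : R, `|a - b| < eps -> E (a, b).
  by move: entE; rewrite -entourage_ballE => -[e /= e0 Ee]; exists e => // a b ab; apply: Ee.
have e2 : 0 < eps / 2 by lra.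
have [delta delta0 close] := cvg _ e2.
have small : \forall t \near 0^'+, 0 < t < delta.
  near=> t; apply/andP; split; near: t; [exact: nbhs_right_gt|exact: nbhs_right_lt].
apply: filterS small => t t_small; apply: EP => x _ /=; apply: epsE.
by rewrite distrC; have := close t t_small i x; lra.
Unshelve. all: by end_near.
Qed.
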